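(* Let $(S,\mathfrak n)$ be a commutative noetherian local ring and let $\omega\in\mathfrak n$ be a non-zerodivisor. Then there is a triangle equivalence functor $\underline{F}:\underline{\mathsf{Mon}}(\omega,\mathcal P)\to\underline{\mathsf{Pair}}(\omega)$.
   Context: All modules are finitely generated. $\mathcal P(S)$ denotes the category of finitely generated projective $S$-modules. $\mathsf{Mon}(\omega,\mathcal P)$ is the category whose objects are $S$-monomorphisms $(P\xrightarrow{f}Q)$ with $P,Q\in\mathcal P(S)$ and $\omega\cdot\operatorname{Coker}f=0$; a morphism $(P\xrightarrow{f}Q)\to(P'\xrightarrow{f'}Q')$ is a pair $(\psi_1,\psi_0)$ of $S$-homomorphisms $\psi_1:P\to P'$, $\psi_0:Q\to Q'$ with $\psi_0f=f'\psi_1$. It is an exact category with conflations the componentwise short exact sequences with all terms in $\mathsf{Mon}(\omega,\mathcal P)$, and it is Frobenius. $\mathsf{Pair}(\omega)$ is the category whose objects are pairs $(\rho_1:P_1\to P_0,\ \rho_0:P_0\to P_1)$ with $P_1,P_0$ projective $S$-modules and $\rho_0\rho_1=\omega\cdot\mathrm{id}_{P_1}$, $\rho_1\rho_0=\omega\cdot\mathrm{id}_{P_0}$; a morphism $(\rho_1,\rho_0)\to(q_1,q_0)$, with $(q_1:Q_1\to Q_0,\ q_0:Q_0\to Q_1)$, is a pair $\psi_1:P_1\to Q_1$, $\psi_0:P_0\to Q_0$ with $\psi_1\rho_0=q_0\psi_0$ and $q_1\psi_1=\psi_0\rho_1$. With conflations the componentwise short exact sequences it is known to be a Frobenius category. The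 stable category $\underline{\mathcal A}$ of a Frobenius category $\mathcal A$ has the same objects, with morphisms taken modulo those factoring through projective objects; it carries its standard (Happel) triangulated structure, whose shift is the inverse of the syzygy functor. *)

(* Defs.v *)
From HB Require Import structures.
From mathcomp Require Import all_boot all_order all_algebra.
From mathcomp Require Import boolp.

Set Implicit Arguments.
Unset Strict Implicit.
Unset Printing Implicit Defensive.

Import GRing.Theory.
Local Open Scope ring_scope.
Local Open Scope quotient_scope.

Record preadditive := Preadditive {
  obj :> Type;
  hom : obj -> obj -> zmodType;
  idm : forall X, hom X X;
  comp : forall X Y Z, hom Y Z -> hom X Y -> hom X Z;
  compA : forall W X Y Z (h : hom Y Z) (g : hom X Y) (f : hom W X),
    comp h (comp g f) = comp (comp h g) f;
  comp1m : forall X Y (f : hom X Y), comp (idm Y) f = f;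
  compm1 : forall X Y (f : hom X Y), comp f (idm X) = f;
  compDl : forall X Y Z (g g' : hom Y Z) (f : hom X Y),
    comp (g + g') f = comp g f + comp g' f;
  compDr : forall X Y Z (g : hom Y Z) (f f' : hom X Y),
    comp g (f + f') = comp g f + comp g f'
}.

Arguments hom {p} X Y.
Arguments idm {p} X.
Arguments comp {p X Y Z} g f.
Notation "g ∘ f" := (comp g f) (at level 40, left associativity).

Section Basics.
Variable C : preadditive.
Implicit Types X Y Z : C.

Lemma comp0m X Y Z (f : hom X Y) : (0 : hom Y Z) ∘ f = 0.
Proof. by apply: (addrI (0 ∘ f)); rewrite -compDl !addr0. Qed.
Lemma compm0 X Y Z (g : hom Y Z) : g ∘ (0 : hom X Y) = 0.
Proof. by apply: (addrI (g ∘ 0)); rewrite -compDr !addr0. Qed.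
Lemma compNl X Y Z (g : hom Y Z) (f : hom X Y) : (- g) ∘ f = - (g ∘ f).
Proof. by apply: (addrI (g ∘ f)); rewrite -compDl !subrr comp0m. Qed.
Lemma compNr X Y Z (g : hom Y Z) (f : hom X Y) : g ∘ (- f) = - (g ∘ f).
Proof. by apply: (addrI (g ∘ f)); rewrite -compDr !subrr compm0. Qed.
Lemma compBl X Y Z (g g' : hom Y Z) (f : hom X Y) :
  (g - g') ∘ f = g ∘ f - g' ∘ f.
Proof. by rewrite compDl compNl. Qed.
Lemma compBr X Y Z (g : hom Y Z) (f f' : hom X Y) :
  g ∘ (f - f') = g ∘ f - g ∘ f'.
Proof. by rewrite compDr compNr. Qed.

Definition is_iso X Y (f : hom X Y) :=
  exists g : hom Y X, g ∘ f = idm X /\ f ∘ g = idm Y.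

Definition is_zero_object Z :=
  forall X, (forall f : hom X Z, f = 0) /\ (forall f : hom Z X, f = 0).

Definition is_biproduct X Y B (i1 : hom X B) (i2 : hom Y B)
    (p1 : hom B X) (p2 : hom B Y) :=
  [/\ p1 ∘ i1 = idm X, p2 ∘ i2 = idm Y, p1 ∘ i2 = 0, p2 ∘ i1 = 0
    & i1 ∘ p1 + i2 ∘ p2 = idm B].

Definition is_additive :=
  (exists Z, is_zero_object Z) /\
  (forall X Y, exists B (i1 : hom X B) (i2 : hom Y B) (p1 : hom B X)
     (p2 : hom B Y), is_biproduct i1 i2 p1 p2).

Definition is_kernel X Y Z (i : hom X Y) (p : hom Y Z) :=
  p ∘ i = 0 /\
  forall W (f : hom W Y), p ∘ f = 0 -> exists! g : hom W X, i ∘ g = f.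

Definition is_cokernel X Y Z (i : hom X Y) (p : hom Y Z) :=
  p ∘ i = 0 /\
  forall W (f : hom Y W), f ∘ i = 0 -> exists! g : hom Z W, g ∘ p = f.

(* [is_pushout i f f' i'] is the square with sides [i : X -> Y], [f : X -> X']
   and opposite sides [i' : X' -> Y'], [f' : Y -> Y']; dually for pullbacks. *)
Definition is_pushout X Y X' Y' (i : hom X Y) (f : hom X X')
    (f' : hom Y Y') (i' : hom X' Y') :=
  f' ∘ i = i' ∘ f /\
  forall W (a : hom Y W) (b : hom X' W), a ∘ i = b ∘ f ->
    exists! c : hom Y' W, c ∘ f' = a /\ c ∘ i' = b.

Definition is_pullback Y Z Y' Z' (p : hom Y Z) (f : hom Z' Z)
    (f' : hom Y' Y) (p' : hom Y' Z') :=
  p ∘ f' = f ∘ p' /\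
  forall W (a : hom W Y) (b : hom W Z'), p ∘ a = f ∘ b ->
    exists! c : hom W Y', f' ∘ c = a /\ p' ∘ c = b.

End Basics.

Definition short_sequences (C : preadditive) :=
  forall X Y Z : C, hom X Y -> hom Y Z -> Prop.

Section Exact.
Variables (C : preadditive) (conf : short_sequences C).
Implicit Types X Y Z : C.

Definition inflation X Y (i : hom X Y) := exists Z (p : hom Y Z), conf i p.
Definition deflation Y Z (p : hom Y Z) := exists X (i : hom X Y), conf i p.

(* Quillen's axioms, in the form of Buehler, Exact categories, Def. 2.1 *)
Record exact_structure : Prop := ExactStructure {
  conf_kernel : forall X Y Z (i : hom X Y) (p : hom Y Z),
    conf i p -> is_kernel i p;
  conf_cokernel : forall X Y Z (i : hom X Y) (p : hom Y Z),
    conf i p -> is_cokernel i p;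
  conf_iso : forall X Y Z X' Y' Z' (i : hom X Y) (p : hom Y Z)
    (i' : hom X' Y') (p' : hom Y' Z')
    (a : hom X X') (b : hom Y Y') (c : hom Z Z'),
    is_iso a -> is_iso b -> is_iso c -> b ∘ i = i' ∘ a -> c ∘ p = p' ∘ b ->
    conf i p -> conf i' p';
  inflation_id : forall X, inflation (idm X);
  deflation_id : forall X, deflation (idm X);
  inflation_comp : forall X Y Z (i : hom X Y) (j : hom Y Z),
    inflation i -> inflation j -> inflation (j ∘ i);
  deflation_comp : forall X Y Z (p : hom X Y) (q : hom Y Z),
    deflation p -> deflation q -> deflation (q ∘ p);
  inflation_pushout : forall X Y X' (i : hom X Y) (f : hom X X'),
    inflation i -> exists Y' (f' : hom Y Y') (i' : hom X' Y'),
      is_pushout i f f' i' /\ inflation i';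
  deflation_pullback : forall Y Z Z' (p : hom Y Z) (f : hom Z' Z),
    deflation p -> exists Y' (f' : hom Y' Y) (p' : hom Y' Z'),
      is_pullback p f f' p' /\ deflation p'
}.

Definition projective_object P :=
  forall Y Z (p : hom Y Z) (f : hom P Z), deflation p ->
    exists g : hom P Y, p ∘ g = f.

Definition injective_object I :=
  forall X Y (i : hom X Y) (f : hom X I), inflation i ->
    exists g : hom Y I, g ∘ i = f.

Record frobenius_structure : Prop := FrobeniusStructure {
  frobenius_additive : is_additive C;
  frobenius_exact : exact_structure;
  enough_projectives : forall X, exists P (p : hom P X),
    projective_object P /\ deflation p;
  enough_injectives : forall X, exists I (i : hom X I),
    injective_object I /\ inflation i;
  projective_injective : forall X, projective_object X <-> injective_object X
}.

End Exact.

Record frobenius_category := FrobeniusCategory {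
  frob_cat :> preadditive;
  conflation : short_sequences frob_cat;
  frobeniusP : frobenius_structure conflation
}.
Arguments conflation {f X Y Z} i p.

Record additive_functor (C D : preadditive) := AdditiveFunctor {
  fobj :> C -> D;
  fmap : forall X Y, hom X Y -> hom (fobj X) (fobj Y);
  fmap1 : forall X, fmap (idm X) = idm (fobj X);
  fmapM : forall X Y Z (g : hom Y Z) (f : hom X Y),
    fmap (g ∘ f) = fmap g ∘ fmap f;
  fmapD : forall X Y (f g : hom X Y), fmap (f + g) = fmap f + fmap g
}.
Arguments fmap {C D} F {X Y} f : rename.

Definition id_functor (C : preadditive) : additive_functor C C.
Proof. by exists id (fun X Y f => f). Defined.

Definition comp_functor (C D E : preadditive) (G : additive_functor D E)
  (F : additive_functor C D) : additive_functor C E.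
Proof.
exists (fun X => G (F X)) (fun X Y f => fmap G (fmap F f)).
- by move=> X; rewrite !fmap1.
- by move=> X Y Z g f; rewrite !fmapM.
- by move=> X Y f g; rewrite !fmapD.
Defined.

Definition natural_iso (C D : preadditive) (F G : additive_functor C D)
    (a : forall X, hom (F X) (G X)) :=
  (forall X, is_iso (a X)) /\
  (forall X Y (f : hom X Y), a Y ∘ fmap F f = fmap G f ∘ a X).

Definition naturally_isomorphic (C D : preadditive)
  (F G : additive_functor C D) := exists a, @natural_iso C D F G a.

Definition is_equivalence (C D : preadditive) (F : additive_functor C D) :=
  exists G : additive_functor D C,
    naturally_isomorphic (comp_functor G F) (id_functor C) /\
    naturally_isomorphic (comp_functor F G) (id_functor D).

Definition isomorphic_triangles (C : preadditive) (T : additive_functor C C)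
    (X Y Z X' Y' Z' : C)
    (u : hom X Y) (v : hom Y Z) (w : hom Z (T X))
    (u' : hom X' Y') (v' : hom Y' Z') (w' : hom Z' (T X')) :=
  exists (a : hom X X') (b : hom Y Y') (c : hom Z Z'),
    [/\ is_iso a, is_iso b & is_iso c] /\
    [/\ b ∘ u = u' ∘ a, c ∘ v = v' ∘ b & fmap T a ∘ w = w' ∘ c].

Arguments isomorphic_triangles {C} T {X Y Z X' Y' Z'} u v w u' v' w'.

(* The data of a triangulated category.  The axioms TR1-TR4 are properties of
   these data; they are not needed to say what a triangle functor is. *)
Record triangulated_data := TriangulatedData {
  tri_cat :> preadditive;
  shift : additive_functor tri_cat tri_cat;
  distinguished : forall X Y Z : tri_cat,
    hom X Y -> hom Y Z -> hom Z (shift X) -> Prop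
}.
Arguments distinguished {t X Y Z} u v w.

Record triangle_functor (T U : triangulated_data) := TriangleFunctor {
  tri_functor :> additive_functor T U;
  tri_shift : forall X : T,
    hom (tri_functor (shift T X)) (shift U (tri_functor X));
  tri_shift_iso : @natural_iso T U (comp_functor tri_functor (shift T))
    (comp_functor (shift U) tri_functor) tri_shift;
  tri_exact : forall (X Y Z : T) (u : hom X Y) (v : hom Y Z)
    (w : hom Z (shift T X)), distinguished u v w ->
    distinguished (fmap tri_functor u) (fmap tri_functor v)
      (tri_shift X ∘ fmap tri_functor w)
}.

Section Stable.
Variable A : frobenius_category.
Implicit Types X Y Z : A.

Definition stably_zero X Y (f : hom X Y) :=
  exists P (a : hom X P) (b : hom P Y),
    projective_object (@conflation A) P /\ f = b ∘ a.

Definition stably_zerob X Y : {pred (hom X Y)} :=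
  fun f => `[< stably_zero f >].

Lemma biproduct_projective P Q B (i1 : hom P B) (i2 : hom Q B)
    (p1 : hom B P) (p2 : hom B Q) :
  is_biproduct i1 i2 p1 p2 -> projective_object (@conflation A) P ->
  projective_object (@conflation A) Q -> projective_object (@conflation A) B.
Proof.
case=> _ _ _ _ e pP pQ Y Z p f dp.
have [g1 h1] := pP _ _ _ (f ∘ i1) dp; have [g2 h2] := pQ _ _ _ (f ∘ i2) dp.
exists (g1 ∘ p1 + g2 ∘ p2).
by rewrite compDr !compA h1 h2 -!compA -compDr e compm1.
Qed.

Lemma stably_zero_closed X Y : zmod_closed (@stably_zerob X Y).
Proof.
split.
  have [P [p [pP _]]] := enough_projectives (frobeniusP A) X.
  by apply/asboolP; exists P, 0, 0; split=> //; rewrite comp0m.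
move=> f f' /asboolP[P [a [b [pP ->]]]] /asboolP[P' [a' [b' [pP' ->]]]].
apply/asboolP.
have [_ /(_ P P') [B [i1 [i2 [p1 [p2 hB]]]]]] := frobenius_additive (frobeniusP A).
exists B, (i1 ∘ a + i2 ∘ a'), (b ∘ p1 - b' ∘ p2); split.
  exact: biproduct_projective hB pP pP'.
case: hB => e1 e2 e3 e4 _.
rewrite compBl !compDr -!compA !(compA p1) !(compA p2) e1 e2 e3 e4.
by rewrite !comp1m !comp0m !compm0 addr0 add0r.
Qed.

HB.instance Definition _ X Y :=
  GRing.isZmodClosed.Build (hom X Y) (@stably_zerob X Y)
    (@stably_zero_closed X Y).

Lemma stably_zero_compl X Y Z (g : hom Y Z) (f : hom X Y) :
  stably_zero f -> stably_zero (g ∘ f).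
Proof. by case=> P [a [b [pP ->]]]; exists P, a, (g ∘ b); rewrite compA. Qed.
Lemma stably_zero_compr X Y Z (g : hom Y Z) (f : hom X Y) :
  stably_zero g -> stably_zero (g ∘ f).
Proof. by case=> P [a [b [pP ->]]]; exists P, (a ∘ f), b; rewrite compA. Qed.

(* morphisms modulo the subgroup of those factoring through a projective *)
Definition stable_hom X Y : zmodType := {ideal_quot (@stably_zerob X Y)}.

Definition stab X Y (f : hom X Y) : stable_hom X Y := \pi f.

Lemma stabP X Y (f g : hom X Y) : stab f = stab g <-> stably_zero (f - g).
Proof.
rewrite /stab; split.
  by move=> /eqP; rewrite -Quotient.idealrBE => /asboolP.
by move=> h; apply/eqP; rewrite -Quotient.idealrBE; apply/asboolP.
Qed.

Lemma stabD X Y (f g : hom X Y) : stab (f + g) = stab f + stab g.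
Proof. exact: raddfD. Qed.

Definition stable_rep X Y (f : stable_hom X Y) : hom X Y := repr f.

Lemma stable_repK X Y (f : stable_hom X Y) : stab (stable_rep f) = f.
Proof. exact: reprK. Qed.

Definition stable_comp X Y Z (g : stable_hom Y Z) (f : stable_hom X Y) :=
  stab (stable_rep g ∘ stable_rep f).

Lemma stab_comp X Y Z (g : hom Y Z) (f : hom X Y) :
  stable_comp (stab g) (stab f) = stab (g ∘ f).
Proof.
have /stabP hg := stable_repK (stab g); have /stabP hf := stable_repK (stab f).
apply/stabP.
have -> : stable_rep (stab g) ∘ stable_rep (stab f) - g ∘ f =
  (stable_rep (stab g) - g) ∘ stable_rep (stab f)
  - g ∘ (f - stable_rep (stab f)).
  by rewrite compBl compBr opprB addrA addrNK.
apply/asboolP.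
rewrite (_ : `[< _ >] = ((stable_rep (stab g) - g) ∘ stable_rep (stab f)
  - g ∘ (f - stable_rep (stab f)) \in @stably_zerob X Z)) //.
apply: rpredB; apply/asboolP; first exact: stably_zero_compr.
by apply: stably_zero_compl; apply/stabP; apply/esym/stabP.
Qed.

Definition stable_category : preadditive.
Proof.
exists (obj A) stable_hom (fun X => stab (idm X)) stable_comp.
- move=> W X Y Z h g f.
  rewrite -(stable_repK h) -(stable_repK g) -(stable_repK f).
  by rewrite !stab_comp compA.
- by move=> X Y f; rewrite -(stable_repK f) stab_comp comp1m.
- by move=> X Y f; rewrite -(stable_repK f) stab_comp compm1.
- move=> X Y Z g g' f.
  rewrite -(stable_repK g) -(stable_repK g') -(stable_repK f).
  by rewrite -stabD !stab_comp compDl stabD.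
- move=> X Y Z g f f'.
  rewrite -(stable_repK g) -(stable_repK f') -(stable_repK f).
  by rewrite -stabD !stab_comp compDr stabD.
Defined.

Definition stable_mor X Y (f : hom X Y) : @hom stable_category X Y := stab f.

(* For a conflation [X -> I -> SX] with [I] projective-injective, [X] is a
   syzygy of [SX]; such conflations, one chosen for every [X], define the
   inverse of the syzygy functor. *)
Record cosyzygy X := Cosyzygy {
  cosyz_inj : A;
  cosyz : A;
  cosyz_in : hom X cosyz_inj;
  cosyz_out : hom cosyz_inj cosyz;
  cosyz_injective : injective_object (@conflation A) cosyz_inj;
  cosyz_conflation : conflation cosyz_in cosyz_out
}.

Lemma cosyzygy_exists X : exists c : cosyzygy X, True.
Proof.
have [I [i [injI [Z [p ip]]]]] := enough_injectives (frobeniusP A) X.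
by exists (Cosyzygy injI ip).
Qed.

Definition the_cosyzygy X : cosyzygy X := projT1 (cid (cosyzygy_exists X)).

Definition inj_hull X : A := cosyz_inj (the_cosyzygy X).
Definition susp X : A := cosyz (the_cosyzygy X).
Definition hull_in X : hom X (inj_hull X) := cosyz_in (the_cosyzygy X).
Definition hull_out X : hom (inj_hull X) (susp X) := cosyz_out (the_cosyzygy X).

Lemma inj_hull_injective X : injective_object (@conflation A) (inj_hull X).
Proof. exact: cosyz_injective. Qed.
Lemma hull_conflation X : conflation (hull_in X) (hull_out X).
Proof. exact: cosyz_conflation. Qed.

(* [g] is induced on cosyzygies by an extension [h] of [f] to the chosen
   injectives:
     X --> I X --> susp X
     |f     |h       |g
     Y --> I Y --> susp Y                                                   *)
Definition suspends X Y (f : hom X Y) (g : hom (susp X) (susp Y)) :=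
  exists h : hom (inj_hull X) (inj_hull Y),
    h ∘ hull_in X = hull_in Y ∘ f /\ g ∘ hull_out X = hull_out Y ∘ h.

Lemma suspends_exists X Y (f : hom X Y) : exists g, suspends f g.
Proof.
have cX := hull_conflation X; have cY := hull_conflation Y.
have [|h hE] := inj_hull_injective (hull_in Y ∘ f) (i := hull_in X).
  by exists (susp X), (hull_out X).
have [_ /(_ _ (hull_out Y ∘ h))] :=
  conf_cokernel (frobenius_exact (frobeniusP A)) cX.
have [kY _] := conf_kernel (frobenius_exact (frobeniusP A)) cY.
case; first by rewrite -compA hE compA kY comp0m.
by move=> g [gE _]; exists g, h.
Qed.

Lemma suspends_stably_zero X Y (f : hom X Y) g :
  suspends f g -> stably_zero f -> stably_zero g.
Proof.
case=> h [h1 h2] [Q [a [b [pQ fE]]]].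
have cX := hull_conflation X; have cY := hull_conflation Y.
have [kY _] := conf_kernel (frobenius_exact (frobeniusP A)) cY.
have iQ : injective_object (@conflation A) Q.
  exact/(projective_injective (frobeniusP A)).
have [|a' a'E] := iQ _ _ _ a (_ : inflation (@conflation A) (hull_in X)).
  by exists (susp X), (hull_out X).
have [pX /(_ _ (h - hull_in Y ∘ b ∘ a'))] :=
  conf_cokernel (frobenius_exact (frobeniusP A)) cX.
case=> [|k [kE _]].
  by rewrite compBl h1 fE -!compA a'E subrr.
have pI : projective_object (@conflation A) (inj_hull Y).
  by apply/(projective_injective (frobeniusP A)); exact: inj_hull_injective.
exists (inj_hull Y), k, (hull_out Y); split=> //.
have [_ /(_ _ (g ∘ hull_out X))] :=
  conf_cokernel (frobenius_exact (frobeniusP A)) cX.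
case=> [|g' [_ gU]]; first by rewrite -compA pX compm0.
rewrite -(gU g (erefl _)); apply: gU.
by rewrite -compA kE compBr h2 !compA kY !comp0m subr0.
Qed.

Lemma suspendsB X Y (f f' : hom X Y) g g' :
  suspends f g -> suspends f' g' -> suspends (f - f') (g - g').
Proof.
move=> [h [h1 h2]] [h' [h1' h2']]; exists (h - h').
by rewrite !compBl !compBr h1 h1' h2 h2'.
Qed.

Lemma suspends_stab X Y (f f' : hom X Y) g g' :
  suspends f g -> suspends f' g' -> stab f = stab f' -> stab g = stab g'.
Proof.
move=> s s' /stabP e; apply/stabP.
exact: suspends_stably_zero (suspendsB s s') e.
Qed.

Definition susp_map X Y (f : stable_hom X Y) : stable_hom (susp X) (susp Y) :=
  stab (projT1 (cid (suspends_exists (stable_rep f)))).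

Lemma susp_mapE X Y (f : hom X Y) g : suspends f g -> susp_map (stab f) = stab g.
Proof.
move=> s; rewrite /susp_map; case: cid => g' s' /=.
by apply: suspends_stab s' s _; rewrite stable_repK.
Qed.

Definition suspension : additive_functor stable_category stable_category.
Proof.
refine (@AdditiveFunctor stable_category stable_category susp susp_map _ _ _).
- move=> X; change (susp_map (stab (@idm A X)) = stab (@idm A (susp X))).
  by apply: susp_mapE; exists (idm _); rewrite !comp1m !compm1.
- move=> X Y Z g f; rewrite -(stable_repK g) -(stable_repK f).
  have [g' sg] := suspends_exists (stable_rep g).
  have [f' sf] := suspends_exists (stable_rep f).
  rewrite (susp_mapE sg) (susp_mapE sf) /= !stab_comp; apply: susp_mapE.
  case: sg sf => [h [h1 h2]] [k [k1 k2]]; exists (h ∘ k).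
  by rewrite -!compA k1 k2 !compA h1 h2.
- move=> X Y f g; rewrite -(stable_repK g) -(stable_repK f).
  have [g' sg] := suspends_exists (stable_rep g).
  have [f' sf] := suspends_exists (stable_rep f).
  rewrite (susp_mapE sg) (susp_mapE sf) /= -!stabD; apply: susp_mapE.
  case: sg sf => [h [h1 h2]] [k [k1 k2]]; exists (k + h).
  by rewrite !compDl !compDr h1 k1 h2 k2.
Defined.

(* the pushout of the chosen conflation of [X] along [u]:
     X --> I X --> susp X
     |u     |b       ||
     Y --> C   --> susp X
        v       w                                                           *)
Definition standard_triangle X Y C (u : hom X Y) (v : hom Y C)
    (w : hom C (susp X)) :=
  exists b : hom (inj_hull X) C,
    [/\ is_pushout (hull_in X) u b v, w ∘ v = 0 & w ∘ b = hull_out X].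

Definition stable_distinguished (X Y Z : stable_category) (u : hom X Y)
    (v : hom Y Z) (w : hom Z (suspension X)) :=
  exists (X' Y' Z' : A) (u' : hom X' Y') (v' : hom Y' Z')
    (w' : hom Z' (susp X')),
    standard_triangle u' v' w' /\
    isomorphic_triangles suspension u v w
      (stable_mor u') (stable_mor v') (stable_mor w').

Definition stable_triangulated : triangulated_data :=
  @TriangulatedData stable_category suspension stable_distinguished.

End Stable.
Section ProjectiveInjective.
Variables (C : preadditive) (conf : short_sequences C).

Lemma projective_retract (P Q : C) (a : hom P Q) (b : hom Q P) :
  b ∘ a = idm P -> projective_object conf Q -> projective_object conf P.
Proof.
move=> e pQ Y Z p f dp; have [g gE] := pQ _ _ _ (f ∘ b) dp.
by exists (g ∘ a); rewrite compA gE -compA e compm1.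
Qed.

Lemma injective_retract (P Q : C) (a : hom P Q) (b : hom Q P) :
  b ∘ a = idm P -> injective_object conf Q -> injective_object conf P.
Proof.
move=> e iQ X Y i f di; have [g gE] := iQ _ _ _ (a ∘ f) di.
by exists (b ∘ g); rewrite -compA gE compA e comp1m.
Qed.

Lemma frobenius_structure_of_enough :
  is_additive C -> exact_structure conf ->
  (forall X, exists P (p : hom P X), [/\ projective_object conf P,
     injective_object conf P & deflation conf p]) ->
  (forall X, exists I (i : hom X I), [/\ projective_object conf I,
     injective_object conf I & inflation conf i]) ->
  frobenius_structure conf.
Proof.
move=> hA hE eP eI; split=> // [X|X|X].
- by have [P [p []]] := eP X; exists P, p.
- by have [I [i []]] := eI X; exists I, i.
- split=> hX.
  + have [P [p [_ iP dp]]] := eP X; have [s sE] := hX _ _ p (idm X) dp.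
    exact: injective_retract sE iP.
  + have [I [i [pI _ di]]] := eI X; have [r rE] := hX _ _ i (idm X) di.
    exact: projective_retract rE pI.
Qed.

End ProjectiveInjective.

Section Transfer.
Variables (C D : preadditive) (F : additive_functor C D).
Variables (cC : short_sequences C) (cD : short_sequences D).
Hypothesis full : forall X Y (h : hom (F X) (F Y)), exists f, fmap F f = h.
Hypothesis faithful : forall X Y (f g : hom X Y), fmap F f = fmap F g -> f = g.
Hypothesis ess : forall Y : D, exists X (e : hom (F X) Y), is_iso e.
Hypothesis confE : forall X Y Z (i : hom X Y) (p : hom Y Z),
  cC i p <-> cD (fmap F i) (fmap F p).
Hypothesis frobD : frobenius_structure cD.
Let exD := frobenius_exact frobD.

Lemma iso_id (E : preadditive) (X : E) : is_iso (idm X).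
Proof. by exists (idm X); rewrite comp1m. Qed.

Lemma fmap0 X Y : fmap F (0 : hom X Y) = 0.
Proof. by apply: (addrI (fmap F 0)); rewrite -fmapD !addr0. Qed.

Lemma fmap_is_iso X Y (f : hom X Y) : is_iso f -> is_iso (fmap F f).
Proof. by case=> g [e1 e2]; exists (fmap F g); rewrite -!fmapM e1 e2 !fmap1. Qed.

Lemma ess_out X (Y : D) (g : hom (F X) Y) :
  exists Y' (g' : hom X Y') (e : hom (F Y') Y) (e' : hom Y (F Y')),
    [/\ e' ∘ e = idm _, e ∘ e' = idm _ & fmap F g' = e' ∘ g].
Proof.
have [Y' [e [e' [h1 h2]]]] := ess Y; have [g' gE] := full (e' ∘ g).
by exists Y', g', e, e'.
Qed.

Lemma ess_in X (Y : D) (g : hom Y (F X)) :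
  exists Y' (g' : hom Y' X) (e : hom (F Y') Y) (e' : hom Y (F Y')),
    [/\ e' ∘ e = idm _, e ∘ e' = idm _ & fmap F g' = g ∘ e].
Proof.
have [Y' [e [e' [h1 h2]]]] := ess Y; have [g' gE] := full (g ∘ e).
by exists Y', g', e, e'.
Qed.

Lemma inflE X Y (i : hom X Y) : inflation cC i <-> inflation cD (fmap F i).
Proof.
split=> [[Z [p /confE ip]]|[Z [p ip]]]; first by exists (F Z), (fmap F p).
have [Z' [p' [e [e' [h1 h2 pE]]]]] := ess_out p.
exists Z', p'; apply/confE; move: ip.
apply: (conf_iso exD (iso_id _) (iso_id _) (c := e')).
- by exists e.
- by rewrite comp1m compm1.
- by rewrite compm1 pE.
Qed.

Lemma deflE X Y (p : hom X Y) : deflation cC p <-> deflation cD (fmap F p).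
Proof.
split=> [[Z [i /confE ip]]|[Z [i ip]]]; first by exists (F Z), (fmap F i).
have [Z' [i' [e [e' [h1 h2 iE]]]]] := ess_in i.
exists Z', i'; apply/confE; move: ip.
apply: (conf_iso exD (a := e') _ (iso_id _) (iso_id _)).
- by exists e.
- by rewrite comp1m iE -compA h2 compm1.
- by rewrite comp1m compm1.
Qed.

Lemma transfer_additive : is_additive C.
Proof.
have [[Z hZ] hB] := frobenius_additive frobD; split.
  have [Z' [e [e' [h1 h2]]]] := ess Z; exists Z' => X.
  have id0 : idm Z' = 0.
    apply: faithful; rewrite fmap1 fmap0 -h1.
    by rewrite (proj1 (hZ _) e) compm0.
  by split=> f; [rewrite -(comp1m f)|rewrite -(compm1 f)];
    rewrite id0 ?comp0m ?compm0.
move=> X Y; have [B [i1 [i2 [p1 [p2 [b1 b2 b3 b4 b5]]]]]] := hB (F X) (F Y).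
have [B' [j1 [e [e' [h1 h2 jE1]]]]] := ess_out i1.
have [j2 jE2] := full (e' ∘ i2).
have [q1 qE1] := full (p1 ∘ e); have [q2 qE2] := full (p2 ∘ e).
have k (W V : D) (x : hom B W) (y : hom V B) : (x ∘ e) ∘ (e' ∘ y) = x ∘ y.
  by rewrite -compA (compA e) h2 comp1m.
exists B', j1, j2, q1, q2; split; apply: faithful;
  rewrite ?fmapD ?fmap1 ?fmapM ?fmap0 ?jE1 ?jE2 ?qE1 ?qE2 ?k //.
by rewrite -!compA -compDr !compA -compDl b5 comp1m h1.
Qed.

Lemma transfer_exact : exact_structure cC.
Proof.
split.
- move=> X Y Z i p /confE /(conf_kernel exD) [e u]; split.
    by apply: faithful; rewrite fmapM e fmap0.
  move=> W f pf.
  have [|h [hE hU]] := u _ (fmap F f); first by rewrite -fmapM pf fmap0.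
  have [g gE] := full h; exists g; split.
    by apply: faithful; rewrite fmapM gE.
  move=> g' g'E; apply: faithful; rewrite gE; apply: hU.
  by rewrite -fmapM g'E.
- move=> X Y Z i p /confE /(conf_cokernel exD) [e u]; split.
    by apply: faithful; rewrite fmapM e fmap0.
  move=> W f pf.
  have [|h [hE hU]] := u _ (fmap F f); first by rewrite -fmapM pf fmap0.
  have [g gE] := full h; exists g; split.
    by apply: faithful; rewrite fmapM gE.
  move=> g' g'E; apply: faithful; rewrite gE; apply: hU.
  by rewrite -fmapM g'E.
- move=> X Y Z X' Y' Z' i p i' p' a b c ia ib ic e1 e2 /confE h; apply/confE.
  apply: (conf_iso exD (fmap_is_iso ia) (fmap_is_iso ib) (fmap_is_iso ic)) h.
  + by rewrite -!fmapM e1.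
  + by rewrite -!fmapM e2.
- by move=> X; apply/inflE; rewrite fmap1; apply: inflation_id.
- by move=> X; apply/deflE; rewrite fmap1; apply: deflation_id.
- move=> X Y Z i j /inflE hi /inflE hj; apply/inflE; rewrite fmapM.
  exact: inflation_comp.
- move=> X Y Z i j /deflE hi /deflE hj; apply/deflE; rewrite fmapM.
  exact: deflation_comp.
- move=> X Y X' i f /inflE hi.
  have [Y' [g [j [[sq u] dj]]]] := inflation_pushout exD (fmap F f) hi.
  have [Y'' [j' [e [e' [h1 h2 jE]]]]] := ess_out j.
  have [g' gE] := full (e' ∘ g).
  exists Y'', g', j'; split; last first.
    apply/inflE; rewrite jE; apply: (inflation_comp exD) => //.
    have [Z [p ip]] := inflation_id exD Y'.
    exists Z, (p ∘ e); move: ip.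
    apply: (conf_iso exD (iso_id _) (b := e') _ (iso_id _)).
    + by exists e.
    + by [].
    + by rewrite comp1m -compA h2 compm1.
  split; first by apply: faithful; rewrite !fmapM gE jE -!compA sq.
  move=> W a b ab.
  have [|h [[hE1 hE2] hU]] := u _ (fmap F a) (fmap F b).
    by rewrite -!fmapM ab.
  have [c cE] := full (h ∘ e); exists c; split.
    by split; apply: faithful; rewrite !fmapM cE ?gE ?jE -compA (compA e) h2 comp1m.
  move=> c' [c'E1 c'E2]; apply: faithful; rewrite cE.
  rewrite (hU (fmap F c' ∘ e')); first by rewrite -compA h1 compm1.
  by rewrite -!compA -gE -jE -!fmapM c'E1 c'E2.
- move=> Y Z Z' p f /deflE hp.
  have [Y' [g [j [[sq u] dj]]]] := deflation_pullback exD (fmap F f) hp.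
  have [Y'' [j' [e [e' [h1 h2 jE]]]]] := ess_in j.
  have [g' gE] := full (g ∘ e).
  exists Y'', g', j'; split; last first.
    apply/deflE; rewrite jE; apply: (deflation_comp exD) => //.
    have [X [i ip]] := deflation_id exD Y'.
    exists X, (e' ∘ i); move: ip.
    apply: (conf_iso exD (iso_id _) (b := e') _ (iso_id _)).
    + by exists e.
    + by rewrite compm1.
    + by rewrite comp1m h2.
  split; first by apply: faithful; rewrite !fmapM gE jE !compA sq.
  move=> W a b ab.
  have [|h [[hE1 hE2] hU]] := u _ (fmap F a) (fmap F b).
    by rewrite -!fmapM ab.
  have [c cE] := full (e' ∘ h); exists c; split.
    by split; apply: faithful; rewrite !fmapM cE ?gE ?jE -compA (compA e) h2 comp1m.
  move=> c' [c'E1 c'E2]; apply: faithful; rewrite cE.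
  rewrite (hU (e ∘ fmap F c')); first by rewrite compA h1 comp1m.
  by rewrite !compA -gE -jE -!fmapM c'E1 c'E2.
Qed.

Lemma transfer_projective X :
  projective_object cD (F X) -> projective_object cC X.
Proof.
move=> pX Y Z p f /deflE dp; have [g gE] := pX _ _ _ (fmap F f) dp.
have [g' g'E] := full g; exists g'; apply: faithful.
by rewrite fmapM g'E.
Qed.

Lemma transfer_injective X :
  injective_object cD (F X) -> injective_object cC X.
Proof.
move=> pX Y Z p f /inflE dp; have [g gE] := pX _ _ _ (fmap F f) dp.
have [g' g'E] := full g; exists g'; apply: faithful.
by rewrite fmapM g'E.
Qed.

Lemma transfer_frobenius : frobenius_structure cC.
Proof.
apply: frobenius_structure_of_enough.
- exact: transfer_additive.
- exact: transfer_exact.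
- move=> X; have [P [p [pP dp]]] := enough_projectives frobD (F X).
  have [P' [p' [e [e' [h1 h2 pE]]]]] := ess_in p.
  have pFP : projective_object cD (F P') by exact: projective_retract h1 pP.
  exists P', p'; split; first exact: transfer_projective.
    by apply: transfer_injective; apply/(projective_injective frobD).
  apply/deflE; rewrite pE; apply: (deflation_comp exD) => //.
  have [Y [i ip]] := deflation_id exD P; exists Y, (e' ∘ i); move: ip.
  apply: (conf_iso exD (iso_id _) (b := e') _ (iso_id _)).
  + by exists e.
  + by rewrite compm1.
  + by rewrite comp1m h2.
- move=> X; have [P [p [pP dp]]] := enough_injectives frobD (F X).
  have [P' [p' [e [e' [h1 h2 pE]]]]] := ess_out p.
  have pFP : injective_object cD (F P') by exact: injective_retract h1 pP.
  exists P', p'; split; last 1 first.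
  + apply/inflE; rewrite pE; apply: (inflation_comp exD) => //.
    have [Y [q ip]] := inflation_id exD P; exists Y, (q ∘ e); move: ip.
    apply: (conf_iso exD (iso_id _) (b := e') _ (iso_id _)).
    * by exists e.
    * by [].
    * by rewrite comp1m -compA h2 compm1.
  + by apply: transfer_projective; apply/(projective_injective frobD).
  + exact: transfer_injective.
Qed.

End Transfer.
Section Rings.
Variable S : comNzRingType.

Definition is_ideal (I : S -> Prop) :=
  [/\ I 0, forall x y, I x -> I y -> I (x + y) & forall a x, I x -> I (a * x)].

Definition noetherian :=
  forall I : S -> Prop, is_ideal I -> exists n (g : 'I_n -> S),
    forall x, I x <-> exists c : 'I_n -> S, x = \sum_i c i * g i.

Definition maximal_ideal (m : S -> Prop) :=
  [/\ is_ideal m, ~ m 1 & forall J : S -> Prop, is_ideal J -> ~ J 1 ->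
    (forall x, m x -> J x) -> forall x, J x -> m x].

(* [m] is the unique maximal ideal *)
Definition local_ring (m : S -> Prop) :=
  maximal_ideal m /\
  forall m' : S -> Prop, maximal_ideal m' -> forall x, m' x <-> m x.

Definition finitely_generated (M : lmodType S) :=
  exists n (g : 'I_n -> M),
    forall x, exists c : 'I_n -> S, x = \sum_i c i *: g i.

Definition projective_module (P : lmodType S) :=
  forall (M N : lmodType S) (p : {linear M -> N}) (f : {linear P -> N}),
    (forall y, exists x, p x = y) ->
    exists g : {linear P -> M}, forall x, p (g x) = f x.

Record fgproj := FGProj {
  fgp_mod :> lmodType S;
  fgp_fg : finitely_generated fgp_mod;
  fgp_proj : projective_module fgp_mod
}.

Section LinearMaps.
Variables U V : lmodType S.
Implicit Types f g : {linear U -> V}.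

Lemma linear_ext f g : (forall x, f x = g x) -> f = g.
Proof.
case: f => f [[fa] [fs]]; case: g => g [[ga] [gs]] /= /funext e.
case: _ / e in ga gs *; congr (GRing.Linear.Pack (GRing.Linear.Class _ _)).
  by congr Algebra.isNmodMorphism.Axioms_; apply: Prop_irrelevance.
by congr GRing.isScalable.Axioms_; apply: Prop_irrelevance.
Qed.

Definition mklin (f : U -> V) (lf : linear f) : {linear U -> V} :=
  HB.pack f (GRing.isLinear.Build S U V *:%R f lf).

End LinearMaps.

Definition short_exact (U V W : lmodType S) (i : {linear U -> V})
    (p : {linear V -> W}) :=
  [/\ injective i, forall z, exists y, p y = z
    & forall y, p y = 0 <-> exists x, i x = y].

Section Mon.
Variable omega : S.

(* [mon_coker] says that omega annihilates the cokernel of [mon_map]. *)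
Record mon_obj := MonObj {
  mon_src : fgproj;
  mon_tgt : fgproj;
  mon_map : {linear mon_src -> mon_tgt};
  mon_mono : injective mon_map;
  mon_coker : forall y, exists x, mon_map x = omega *: y
}.

Record mon_hom (X Y : mon_obj) := MonHom {
  mh1 : {linear mon_src X -> mon_src Y};
  mh0 : {linear mon_tgt X -> mon_tgt Y};
  mhE : forall x, mh0 (mon_map X x) = mon_map Y (mh1 x)
}.

Lemma mon_hom_ext X Y (f g : mon_hom X Y) :
  (forall x, mh1 f x = mh1 g x) -> (forall x, mh0 f x = mh0 g x) -> f = g.
Proof.
case: f g => [f1 f0 fE] [g1 g0 gE] /= /linear_ext e1 /linear_ext e0.
by case: _ / e1 in gE *; case: _ / e0 in gE *; congr MonHom; apply: Prop_irrelevance.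
Qed.

HB.instance Definition _ X Y := gen_eqMixin (mon_hom X Y).
HB.instance Definition _ X Y := gen_choiceMixin (mon_hom X Y).

Section MonHomZmod.
Variables X Y : mon_obj.
Implicit Types f g h : mon_hom X Y.

Definition mon_zero : mon_hom X Y.
Proof. by exists \0 \0 => x /=; rewrite raddf0. Defined.
Definition mon_opp f : mon_hom X Y.
Proof. by exists (\- mh1 f) (\- mh0 f) => x /=; rewrite raddfN mhE. Defined.
Definition mon_add f g : mon_hom X Y.
Proof.
by exists (mh1 f \+ mh1 g) (mh0 f \+ mh0 g) => x /=; rewrite raddfD !mhE.
Defined.

Lemma mon_addA : associative mon_add.
Proof. by move=> f g h; apply: mon_hom_ext => x; apply: addrA. Qed.
Lemma mon_addC : commutative mon_add.
Proof. by move=> f g; apply: mon_hom_ext => x; apply: addrC. Qed.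
Lemma mon_add0 : left_id mon_zero mon_add.
Proof. by move=> f; apply: mon_hom_ext => x; apply: add0r. Qed.
Lemma mon_addN : left_inverse mon_zero mon_opp mon_add.
Proof. by move=> f; apply: mon_hom_ext => x; apply: addNr. Qed.

HB.instance Definition _ := GRing.isZmodule.Build (mon_hom X Y)
  mon_addA mon_addC mon_add0 mon_addN.
End MonHomZmod.

Definition mon_id X : mon_hom X X.
Proof. by exists idfun idfun. Defined.
Definition mon_comp X Y Z (g : mon_hom Y Z) (f : mon_hom X Y) : mon_hom X Z.
Proof. by exists (mh1 g \o mh1 f) (mh0 g \o mh0 f) => x /=; rewrite !mhE. Defined.

Definition mon_preadditive : preadditive.
Proof.
exists mon_obj mon_hom mon_id mon_comp.
- by move=> *; apply: mon_hom_ext.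
- by move=> X Y f; apply: mon_hom_ext.
- by move=> X Y f; apply: mon_hom_ext.
- by move=> X Y Z g g' f; apply: mon_hom_ext.
- by move=> X Y Z g f f'; apply: mon_hom_ext => x; apply: raddfD.
Defined.

Definition mon_conflation : short_sequences mon_preadditive :=
  fun X Y Z i p => short_exact (mh1 i) (mh1 p) /\ short_exact (mh0 i) (mh0 p).

End Mon.

Section Pair.
Variable omega : S.

Record pair_obj := PairObj {
  pair_P1 : fgproj;
  pair_P0 : fgproj;
  rho1 : {linear pair_P1 -> pair_P0};
  rho0 : {linear pair_P0 -> pair_P1};
  rho01 : forall x, rho0 (rho1 x) = omega *: x;
  rho10 : forall x, rho1 (rho0 x) = omega *: x
}.

Record pair_hom (X Y : pair_obj) := PairHom {
  ph1 : {linear pair_P1 X -> pair_P1 Y};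
  ph0 : {linear pair_P0 X -> pair_P0 Y};
  ph1E : forall x, ph1 (rho0 X x) = rho0 Y (ph0 x);
  ph0E : forall x, rho1 Y (ph1 x) = ph0 (rho1 X x)
}.

Lemma pair_hom_ext X Y (f g : pair_hom X Y) :
  (forall x, ph1 f x = ph1 g x) -> (forall x, ph0 f x = ph0 g x) -> f = g.
Proof.
case: f g => [f1 f0 fE fE'] [g1 g0 gE gE'] /= /linear_ext e1 /linear_ext e0.
case: _ / e1 in gE gE' *; case: _ / e0 in gE gE' *.
by congr PairHom; apply: Prop_irrelevance.
Qed.

HB.instance Definition _ X Y := gen_eqMixin (pair_hom X Y).
HB.instance Definition _ X Y := gen_choiceMixin (pair_hom X Y).

Section PairHomZmod.
Variables X Y : pair_obj.
Implicit Types f g h : pair_hom X Y.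

Definition pair_zero : pair_hom X Y.
Proof. by exists \0 \0 => x /=; rewrite raddf0. Defined.
Definition pair_opp f : pair_hom X Y.
Proof.
by exists (\- ph1 f) (\- ph0 f) => x /=; rewrite raddfN; congr (- _);
  [apply: ph1E | apply: ph0E].
Defined.
Definition pair_add f g : pair_hom X Y.
Proof.
by exists (ph1 f \+ ph1 g) (ph0 f \+ ph0 g) => x /=;
  rewrite raddfD; [rewrite !ph1E | rewrite -!ph0E].
Defined.

Lemma pair_addA : associative pair_add.
Proof. by move=> f g h; apply: pair_hom_ext => x; apply: addrA. Qed.
Lemma pair_addC : commutative pair_add.
Proof. by move=> f g; apply: pair_hom_ext => x; apply: addrC. Qed.
Lemma pair_add0 : left_id pair_zero pair_add.
Proof. by move=> f; apply: pair_hom_ext => x; apply: add0r. Qed.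
Lemma pair_addN : left_inverse pair_zero pair_opp pair_add.
Proof. by move=> f; apply: pair_hom_ext => x; apply: addNr. Qed.

HB.instance Definition _ := GRing.isZmodule.Build (pair_hom X Y)
  pair_addA pair_addC pair_add0 pair_addN.
End PairHomZmod.

Definition pair_id X : pair_hom X X.
Proof. by exists idfun idfun. Defined.
Definition pair_comp X Y Z (g : pair_hom Y Z) (f : pair_hom X Y) :
  pair_hom X Z.
Proof.
by exists (ph1 g \o ph1 f) (ph0 g \o ph0 f) => x /=;
  [rewrite !ph1E | rewrite !ph0E].
Defined.

Definition pair_preadditive : preadditive.
Proof.
exists pair_obj pair_hom pair_id pair_comp.
- by move=> *; apply: pair_hom_ext.
- by move=> X Y f; apply: pair_hom_ext.
- by move=> X Y f; apply: pair_hom_ext.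
- by move=> X Y Z g g' f; apply: pair_hom_ext.
- by move=> X Y Z g f f'; apply: pair_hom_ext => x; apply: raddfD.
Defined.

Definition pair_conflation : short_sequences pair_preadditive :=
  fun X Y Z i p => short_exact (ph1 i) (ph1 p) /\ short_exact (ph0 i) (ph0 p).

End Pair.
End Rings.
Section PairFrobenius.
Variables (S : comNzRingType) (omega : S).
Local Notation Pair := (pair_preadditive omega).
Local Notation pconf := (@pair_conflation S omega).

Lemma scal_lin (U V : lmodType S) (f : {linear U -> V}) a x :
  f (a *: x) = a *: f x.
Proof. exact: linearZZ. Qed.

Section Splittings.
Variables U V W : lmodType S.

Record splitting (i : {linear U -> V}) (p : {linear V -> W})
    (r : {linear V -> U}) (s : {linear W -> V}) : Prop := Splitting {
  split_ri : forall x, r (i x) = x;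
  split_ps : forall z, p (s z) = z;
  split_id : forall y, i (r y) + s (p y) = y
}.

Variables (i : {linear U -> V}) (p : {linear V -> W}).
Variables (r : {linear V -> U}) (s : {linear W -> V}).

Lemma split_pi : splitting i p r s -> forall x, p (i x) = 0.
Proof.
case=> ri ps id x; move: (id (i x)); rewrite ri -[RHS]addr0 => /addrI e.
by rewrite -(ps (p (i x))) e linear0.
Qed.

Lemma split_rs : splitting i p r s -> forall z, r (s z) = 0.
Proof.
case=> ri ps id z; move: (id (s z)); rewrite ps -[RHS]add0r => /addIr e.
by rewrite -(ri (r (s z))) e linear0.
Qed.

Lemma split_exact : splitting i p r s -> short_exact i p.
Proof.
move=> h; case: (h) => ri ps id; split.
- exact: can_inj ri.
- by move=> z; exists (s z).
- move=> y; split=> [e|[x <-]]; last exact: split_pi.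
  by exists (r y); rewrite -[RHS]id e linear0 addr0.
Qed.

End Splittings.

Lemma exact_split (U V : lmodType S) (W : fgproj S) (i : {linear U -> V})
  (p : {linear V -> W}) : short_exact i p -> exists r s, splitting i p r s.
Proof.
case=> inj sur ex.
have [s sE] := @fgp_proj _ W V W p idfun sur.
have h y : exists x, i x = y - s (p y).
  by apply/ex; rewrite linearB sE subrr.
pose r y := projT1 (cid (h y)).
have rE y : i (r y) = y - s (p y) by rewrite /r; case: cid.
have lr : linear r.
  move=> a x y; apply: inj.
  by rewrite (linearP i) !rE (linearP p) (linearP s) opprD scalerBr addrACA.
exists (mklin lr), s; split=> //= [x|y].
- apply: inj; rewrite rE; have -> : p (i x) = 0 by apply/ex; exists x.
  by rewrite linear0 subr0.
- by rewrite rE subrK.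
Qed.

Lemma short_exact_iso (U V W U' V' W' : lmodType S)
  (i : {linear U -> V}) (p : {linear V -> W})
  (i' : {linear U' -> V'}) (p' : {linear V' -> W'})
  (a : {linear U -> U'}) (b : {linear V -> V'}) (c : {linear W -> W'})
  (a' : {linear U' -> U}) (b' : {linear V' -> V}) (c' : {linear W' -> W}) :
  cancel a a' -> cancel a' a -> cancel b b' -> cancel b' b ->
  cancel c c' -> cancel c' c ->
  (forall x, b (i x) = i' (a x)) -> (forall y, c (p y) = p' (b y)) ->
  short_exact i p -> short_exact i' p'.
Proof.
move=> aK a'K bK b'K cK c'K e1 e2 [inj sur ex]; split.
- move=> x y e; rewrite -(a'K x) -(a'K y); congr (a _); apply: inj.
  by apply: (can_inj bK); rewrite !e1 !a'K.
- move=> z; have [y yE] := sur (c' z); exists (b y).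
  by rewrite -e2 yE c'K.
- move=> y; split=> [e|[x <-]].
  + have [|x xE] := (ex (b' y)).1.
      by apply: (can_inj cK); rewrite e2 b'K e linear0.
    by exists (a x); rewrite -e1 xE b'K.
  + rewrite -(a'K x) -e1 -e2; have -> : p (i (a' x)) = 0.
      by apply/ex; exists (a' x).
    by rewrite linear0.
Qed.

Lemma fg_image (U V : lmodType S) (p : {linear U -> V}) :
  (forall y, exists x, p x = y) ->
  finitely_generated U -> finitely_generated V.
Proof.
move=> sur [n [g gE]]; exists n, (fun i => p (g i)) => y.
have [x <-] := sur y; have [c ->] := gE x; exists c.
by rewrite linear_sum; apply: eq_bigr => i _; rewrite scal_lin.
Qed.

Lemma fg_prod (U V : lmodType S) : finitely_generated U ->
  finitely_generated V -> finitely_generated (U * V)%type.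
Proof.
move=> [n [g gE]] [m [h hE]].
exists (n + m)%N, (fun k => match split k with
  inl i => (g i, 0) | inr j => (0, h j) end) => -[x y].
have [c ->] := gE x; have [d ->] := hE y.
exists (fun k => match split k with inl i => c i | inr j => d j end).
pose F (k : 'I_(n + m)) : (U * V)%type :=
  match split k with inl i => c i | inr j => d j end *:
  match split k with inl i => (g i, 0) | inr j => (0, h j) end.
change ((\sum_i c i *: g i, \sum_i d i *: h i) = \sum_k F k).
have pr1 : (\sum_k F k).1 = \sum_i c i *: g i.
  rewrite (raddf_sum (@fst U V)) big_split_ord /= [X in _ + X]big1 ?addr0.
    apply: eq_bigr => i _; rewrite /F; case: splitP => [j /= /val_inj <-|j /= e] //.
    by have := ltn_ord i; rewrite e -ltn_subRL subnn.
  move=> i _; rewrite /F; case: splitP => [j /= e|j _] /=; last exact: scaler0.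
  by have := ltn_ord j; rewrite -e -ltn_subRL subnn.
have pr2 : (\sum_k F k).2 = \sum_i d i *: h i.
  rewrite (raddf_sum (@snd U V)) big_split_ord /= big1 ?add0r.
    apply: eq_bigr => i _; rewrite /F; case: splitP => [j /= e|j /= /addnI /val_inj <-] //.
    by have := ltn_ord j; rewrite -e -ltn_subRL subnn.
  move=> i _; rewrite /F; case: splitP => [j _|j /= e] /=; first exact: scaler0.
  by have := ltn_ord i; rewrite e -ltn_subRL subnn.
by rewrite -pr1 -pr2 -surjective_pairing.
Qed.

Lemma projective_prod (U V : lmodType S) : projective_module U ->
  projective_module V -> projective_module (U * V)%type.
Proof.
move=> pU pV M N p f sur.
have l1 : linear (fun x : U => f (x, 0)).
  move=> a x y; rewrite -linearP; congr (f _); congr pair.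
  by rewrite /= scaler0 addr0.
have l2 : linear (fun y : V => f (0, y)).
  move=> a x y; rewrite -linearP; congr (f _); congr pair.
  by rewrite /= scaler0 addr0.
have [g gE] := pU _ _ p (mklin l1) sur; have [h hE] := pV _ _ p (mklin l2) sur.
exists ((g \o fst) \+ (h \o snd)) => -[x y] /=.
rewrite linearD gE hE /= -linearD; congr (f _); congr pair => /=.
  by rewrite addr0.
by rewrite add0r.
Qed.

Definition fgproj_prod (P Q : fgproj S) : fgproj S :=
  FGProj (fg_prod (fgp_fg P) (fgp_fg Q))
    (projective_prod (@fgp_proj _ P) (@fgp_proj _ Q)).

Lemma fg_row0 : finitely_generated 'rV[S]_0.
Proof. by exists 0, (fun=> 0) => x; exists (fun=> 0); rewrite big_ord0 [x]thinmx0. Qed.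

Lemma projective_row0 : projective_module 'rV[S]_0.
Proof.
move=> M N p f sur; exists \0 => x /=.
by rewrite [x]thinmx0 !linear0.
Qed.

Definition fgproj0 : fgproj S := FGProj fg_row0 projective_row0.

(* the cokernel of a componentwise split monomorphism *)

Section Cokernel.
Variables (X Y : Pair) (m : hom X Y) (C1 C0 : fgproj S).
Variables (p1 : {linear pair_P1 Y -> C1}) (r1 : {linear pair_P1 Y -> pair_P1 X})
  (s1 : {linear C1 -> pair_P1 Y}).
Variables (p0 : {linear pair_P0 Y -> C0}) (r0 : {linear pair_P0 Y -> pair_P0 X})
  (s0 : {linear C0 -> pair_P0 Y}).
Hypotheses (h1 : splitting (ph1 m) p1 r1 s1) (h0 : splitting (ph0 m) p0 r0 s0).

Let p1r x : p1 (rho0 Y x) = p1 (rho0 Y (s0 (p0 x))).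
Proof.
rewrite -{1}(split_id h0 x) (linearD (rho0 Y)) (linearD p1) -ph1E.
by rewrite (split_pi h1) add0r.
Qed.
Let p0r x : p0 (rho1 Y x) = p0 (rho1 Y (s1 (p1 x))).
Proof.
rewrite -{1}(split_id h1 x) (linearD (rho1 Y)) (linearD p0) ph0E.
by rewrite (split_pi h0) add0r.
Qed.

Definition coker_pair : Pair.
Proof.
apply: (@PairObj _ omega C1 C0 (p0 \o rho1 Y \o s1) (p1 \o rho0 Y \o s0)) => x /=.
- by rewrite -p1r rho01 scal_lin (split_ps h1).
- by rewrite -p0r rho10 scal_lin (split_ps h0).
Defined.

Definition coker_pair_map : @hom Pair Y coker_pair.
Proof. by exists p1 p0 => x /=; rewrite -?p1r -?p0r. Defined.

Lemma coker_pair_conf : pconf m coker_pair_map.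
Proof. by split; [exact: split_exact h1 | exact: split_exact h0]. Qed.

End Cokernel.

Section Kernel.
Variables (Y Z : Pair) (p : hom Y Z) (K1 K0 : fgproj S).
Variables (i1 : {linear K1 -> pair_P1 Y}) (r1 : {linear pair_P1 Y -> K1})
  (s1 : {linear pair_P1 Z -> pair_P1 Y}).
Variables (i0 : {linear K0 -> pair_P0 Y}) (r0 : {linear pair_P0 Y -> K0})
  (s0 : {linear pair_P0 Z -> pair_P0 Y}).
Hypotheses (h1 : splitting i1 (ph1 p) r1 s1) (h0 : splitting i0 (ph0 p) r0 s0).

Let i1r x : i1 (r1 (rho0 Y (i0 x))) = rho0 Y (i0 x).
Proof.
rewrite -[RHS](split_id h1) ph1E (split_pi h0).
by rewrite (linear0 (rho0 Z)) (linear0 s1) addr0.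
Qed.
Let i0r x : i0 (r0 (rho1 Y (i1 x))) = rho1 Y (i1 x).
Proof.
rewrite -[RHS](split_id h0) -ph0E (split_pi h1).
by rewrite (linear0 (rho1 Z)) (linear0 s0) addr0.
Qed.

Definition ker_pair : Pair.
Proof.
apply: (@PairObj _ omega K1 K0 (r0 \o rho1 Y \o i1) (r1 \o rho0 Y \o i0)) => x /=.
- by rewrite i0r rho01 scal_lin (split_ri h1).
- by rewrite i1r rho10 scal_lin (split_ri h0).
Defined.

Definition ker_pair_map : @hom Pair ker_pair Y.
Proof. by exists i1 i0 => x /=; rewrite ?i1r ?i0r. Defined.

Lemma ker_pair_conf : pconf ker_pair_map p.
Proof. by split; [exact: split_exact h1 | exact: split_exact h0]. Qed.

End Kernel.

Definition split_mono (U V : lmodType S) (i : {linear U -> V}) :=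
  exists (W : fgproj S) (p : {linear V -> W}) r s, splitting i p r s.
Definition split_epi (V W : lmodType S) (p : {linear V -> W}) :=
  exists (U : fgproj S) (i : {linear U -> V}) r s, splitting i p r s.

Lemma pair_inflE X Y (i : @hom Pair X Y) :
  inflation pconf i <-> split_mono (ph1 i) /\ split_mono (ph0 i).
Proof.
split=> [[Z [p [/exact_split[r1 [s1 e1]] /exact_split[r0 [s0 e0]]]]]|].
  by split; [exists (pair_P1 Z), (ph1 p), r1, s1|exists (pair_P0 Z), (ph0 p), r0, s0].
move=> [[C1 [p1 [r1 [s1 e1]]]] [C0 [p0 [r0 [s0 e0]]]]].
by exists (coker_pair e1 e0), (coker_pair_map e1 e0); apply: coker_pair_conf.
Qed.

Lemma pair_deflE Y Z (p : @hom Pair Y Z) :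
  deflation pconf p <-> split_epi (ph1 p) /\ split_epi (ph0 p).
Proof.
split=> [[X [i [/exact_split[r1 [s1 e1]] /exact_split[r0 [s0 e0]]]]]|].
  by split; [exists (pair_P1 X), (ph1 i), r1, s1|exists (pair_P0 X), (ph0 i), r0, s0].
move=> [[K1 [i1 [r1 [s1 e1]]]] [K0 [i0 [r0 [s0 e0]]]]].
by exists (ker_pair e1 e0), (ker_pair_map e1 e0); apply: ker_pair_conf.
Qed.

Lemma split_mono_id (U : lmodType S) : split_mono (idfun : {linear U -> U}).
Proof. by exists fgproj0, \0, idfun, \0; split=> //= [z|y]; rewrite ?[z]thinmx0 ?addr0. Qed.

Lemma split_epi_id (U : lmodType S) : split_epi (idfun : {linear U -> U}).
Proof. by exists fgproj0, \0, \0, idfun; split=> //= [z|y]; rewrite ?[z]thinmx0 ?add0r. Qed.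

Section PairLin.
Variables U V W : lmodType S.
Definition lfst : {linear (U * V)%type -> U} := fst.
Definition lsnd : {linear (U * V)%type -> V} := snd.
Variables (f : {linear U -> V}) (g : {linear U -> W}).
Lemma pairing_linear : linear (fun x => (f x, g x)).
Proof. by move=> a x y; rewrite !linearP. Qed.
Definition pairing : {linear U -> (V * W)%type} := mklin pairing_linear.
Variables (h : {linear V -> U}) (k : {linear W -> U}).
Definition copairing : {linear (V * W)%type -> U} := (h \o fst) \+ (k \o snd).
End PairLin.

Lemma split_mono_comp (U V W : lmodType S) (i : {linear U -> V})
  (j : {linear V -> W}) : split_mono i -> split_mono j -> split_mono (j \o i).
Proof.
move=> [C [p [r [s h]]]] [D [q [t [u k]]]].
exists (fgproj_prod C D), (pairing (p \o t) q), (r \o t), (copairing (j \o s) u).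
split=> [x|[c d]|y] /=.
- by rewrite (split_ri k) (split_ri h).
- rewrite (linearD t) (linearD q) (split_ri k) (split_rs k) (split_pi k).
  by rewrite addr0 add0r (split_ps h) (split_ps k).
- by rewrite addrA -linearD (split_id h) (split_id k).
Qed.

Lemma split_epi_comp (U V W : lmodType S) (p : {linear U -> V})
  (q : {linear V -> W}) : split_epi p -> split_epi q -> split_epi (q \o p).
Proof.
move=> [C [i [r [s h]]]] [D [j [t [u k]]]].
exists (fgproj_prod C D), (copairing i (s \o j)), (pairing r (t \o p)), (s \o u).
split=> [[c d]|z|y] /=.
- rewrite (linearD r) (linearD p) (split_ri h) (split_rs h) (split_pi h).
  by rewrite addr0 add0r (split_ps h) (split_ri k).
- by rewrite (split_ps h) (split_ps k).
- by rewrite -addrA -linearD (split_id k) (split_id h).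
Qed.

Lemma pair_conf_split X Y Z (i : @hom Pair X Y) (p : @hom Pair Y Z) :
  pconf i p -> (exists r s, splitting (ph1 i) (ph1 p) r s) /\
    (exists r s, splitting (ph0 i) (ph0 p) r s).
Proof. by move=> [/exact_split h1 /exact_split h0]. Qed.

Lemma pair_homP1 (X Y : Pair) (f g : hom X Y) : f = g -> forall x, ph1 f x = ph1 g x.
Proof. by move->. Qed.
Lemma pair_homP0 (X Y : Pair) (f g : hom X Y) : f = g -> forall x, ph0 f x = ph0 g x.
Proof. by move->. Qed.

Lemma pair_kernel X Y Z (i : @hom Pair X Y) (p : @hom Pair Y Z) :
  pconf i p -> is_kernel i p.
Proof.
move=> /pair_conf_split[[r1 [s1 h1]] [r0 [s0 h0]]]; split.
  by apply: pair_hom_ext => x /=; [exact: (split_pi h1) | exact: (split_pi h0)].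
move=> W f pf.
have e1 x : ph1 i (r1 (ph1 f x)) = ph1 f x.
  by rewrite -[RHS](split_id h1) [ph1 p _](pair_homP1 pf) linear0 addr0.
have e0 x : ph0 i (r0 (ph0 f x)) = ph0 f x.
  by rewrite -[RHS](split_id h0) [ph0 p _](pair_homP0 pf) linear0 addr0.
have g1 x : (r1 \o ph1 f) (rho0 W x) = rho0 X ((r0 \o ph0 f) x).
  by apply: (can_inj (split_ri h1)); rewrite /= e1 (ph1E i) e0 (ph1E f).
have g0 x : rho1 X ((r1 \o ph1 f) x) = (r0 \o ph0 f) (rho1 W x).
  by apply: (can_inj (split_ri h0)); rewrite /= e0 -(ph0E i) e1 (ph0E f).
exists (PairHom g1 g0); split; first by apply: pair_hom_ext.
move=> g gE; apply: pair_hom_ext => x /=.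
  by rewrite -(pair_homP1 gE) /= (split_ri h1).
by rewrite -(pair_homP0 gE) /= (split_ri h0).
Qed.

Lemma pair_cokernel X Y Z (i : @hom Pair X Y) (p : @hom Pair Y Z) :
  pconf i p -> is_cokernel i p.
Proof.
move=> /pair_conf_split[[r1 [s1 h1]] [r0 [s0 h0]]]; split.
  by apply: pair_hom_ext => x /=; [exact: (split_pi h1) | exact: (split_pi h0)].
move=> W f fi.
have e1 x : ph1 f (s1 (ph1 p x)) = ph1 f x.
  rewrite -[in RHS](split_id h1 x) (linearD (ph1 f)).
  by rewrite [ph1 f (ph1 i _)](pair_homP1 fi) add0r.
have e0 x : ph0 f (s0 (ph0 p x)) = ph0 f x.
  rewrite -[in RHS](split_id h0 x) (linearD (ph0 f)).
  by rewrite [ph0 f (ph0 i _)](pair_homP0 fi) add0r.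
have g1 x : (ph1 f \o s1) (rho0 Z x) = rho0 W ((ph0 f \o s0) x).
  by rewrite -(split_ps h0 x) -(ph1E p) /= e1 e0 (ph1E f).
have g0 x : rho1 W ((ph1 f \o s1) x) = (ph0 f \o s0) (rho1 Z x).
  by rewrite -(split_ps h1 x) (ph0E p) /= e1 e0 (ph0E f).
exists (PairHom g1 g0); split; first by apply: pair_hom_ext.
move=> g gE; apply: pair_hom_ext => x /=.
  by rewrite -(pair_homP1 gE) /= (split_ps h1).
by rewrite -(pair_homP0 gE) /= (split_ps h0).
Qed.

Lemma pair_conf_iso X Y Z X' Y' Z' (i : @hom Pair X Y) (p : @hom Pair Y Z)
    (i' : @hom Pair X' Y') (p' : @hom Pair Y' Z')
    (a : hom X X') (b : hom Y Y') (c : hom Z Z') :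
    is_iso a -> is_iso b -> is_iso c -> b ∘ i = i' ∘ a -> c ∘ p = p' ∘ b ->
    pconf i p -> pconf i' p'.
Proof.
move=> [a' [a1 a2]] [b' [b1 b2]] [c' [c1 c2]] e1 e2 [h1 h0]; split.
- apply: (short_exact_iso (a := ph1 a) (a' := ph1 a') (b := ph1 b)
    (b' := ph1 b') (c := ph1 c) (c' := ph1 c')) h1.
  + exact: pair_homP1 a1.
  + exact: pair_homP1 a2.
  + exact: pair_homP1 b1.
  + exact: pair_homP1 b2.
  + exact: pair_homP1 c1.
  + exact: pair_homP1 c2.
  + exact: pair_homP1 e1.
  + exact: pair_homP1 e2.
- apply: (short_exact_iso (a := ph0 a) (a' := ph0 a') (b := ph0 b)
    (b' := ph0 b') (c := ph0 c) (c' := ph0 c')) h0.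
  + exact: pair_homP0 a1.
  + exact: pair_homP0 a2.
  + exact: pair_homP0 b1.
  + exact: pair_homP0 b2.
  + exact: pair_homP0 c1.
  + exact: pair_homP0 c2.
  + exact: pair_homP0 e1.
  + exact: pair_homP0 e2.
Qed.

Section Biproduct.
Variables X Y : Pair.

Definition pair_sum : Pair.
Proof.
apply: (@PairObj _ omega (fgproj_prod (pair_P1 X) (pair_P1 Y))
  (fgproj_prod (pair_P0 X) (pair_P0 Y))
  (pairing (rho1 X \o lfst _ _) (rho1 Y \o lsnd _ _))
  (pairing (rho0 X \o lfst _ _) (rho0 Y \o lsnd _ _))) => -[x y] /=.
- by rewrite !rho01.
- by rewrite !rho10.
Defined.

Definition pair_in1 : @hom Pair X pair_sum.
Proof.
exists (pairing idfun \0) (pairing idfun \0) => x /=; by rewrite linear0.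
Defined.
Definition pair_in2 : @hom Pair Y pair_sum.
Proof.
exists (pairing \0 idfun) (pairing \0 idfun) => x /=; by rewrite linear0.
Defined.
Definition pair_pr1 : @hom Pair pair_sum X.
Proof. by exists (lfst _ _) (lfst _ _). Defined.
Definition pair_pr2 : @hom Pair pair_sum Y.
Proof. by exists (lsnd _ _) (lsnd _ _). Defined.

Lemma pair_biproduct : is_biproduct pair_in1 pair_in2 pair_pr1 pair_pr2.
Proof.
split; apply: pair_hom_ext => //= -[x y] //=; congr pair => /=;
  by rewrite ?addr0 ?add0r.
Qed.
End Biproduct.

Lemma pair_additive : is_additive Pair.
Proof.
split; last first.
  move=> X Y; exists (pair_sum X Y), (pair_in1 X Y), (pair_in2 X Y),
    (pair_pr1 X Y), (pair_pr2 X Y); exact: pair_biproduct.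
have h (x : fgproj0) : (\0 : {linear fgproj0 -> fgproj0}) (\0 x) = omega *: x.
  by rewrite [RHS]thinmx0 [LHS]thinmx0.
exists (PairObj h h) => X; split=> f; apply: pair_hom_ext => x /=.
- by rewrite [LHS]thinmx0 [RHS]thinmx0.
- by rewrite [LHS]thinmx0 [RHS]thinmx0.
- by rewrite [x]thinmx0 !linear0.
- by rewrite [x]thinmx0 !linear0.
Qed.

Lemma pushout_of_cokernel (C : preadditive) (X Y X' B Y' : C)
    (i : hom X Y) (f : hom X X') (i1 : hom Y B) (i2 : hom X' B)
    (p1 : hom B Y) (p2 : hom B X') (c : hom B Y') :
  is_biproduct i1 i2 p1 p2 -> is_cokernel (i1 ∘ i + i2 ∘ f) c ->
  is_pushout i f (c ∘ i1) (- (c ∘ i2)).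
Proof.
move=> [b1 b2 b3 b4 b5] [e u]; split.
  apply/eqP; rewrite -subr_eq0 compNl opprK; apply/eqP.
  by rewrite -e compDr !compA.
move=> W a b ab.
have [|g [gE gU]] := u _ (a ∘ p1 - b ∘ p2).
  rewrite compBl !compDr -!compA !(compA p1) !(compA p2) b1 b2 b3 b4.
  by rewrite !comp1m !comp0m !compm0 addr0 add0r ab subrr.
exists g; split.
  rewrite compNr !compA gE !compBl -!compA b1 b2 b3 b4.
  by rewrite !compm1 !compm0 subr0 sub0r opprK.
move=> g' [g1 g2]; apply: gU.
rewrite -[g' ∘ c]compm1 -b5 compDr !compA -(compA g') g1 -(compA g' c) -g2.
by rewrite compNr compNl opprK.
Qed.

Lemma pullback_of_kernel (C : preadditive) (Y Z Z' B Y' : C)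
    (p : hom Y Z) (f : hom Z' Z) (i1 : hom Y B) (i2 : hom Z' B)
    (p1 : hom B Y) (p2 : hom B Z') (k : hom Y' B) :
  is_biproduct i1 i2 p1 p2 -> is_kernel k (p ∘ p1 - f ∘ p2) ->
  is_pullback p f (p1 ∘ k) (p2 ∘ k).
Proof.
move=> [b1 b2 b3 b4 b5] [e u]; split.
  by apply/eqP; rewrite -subr_eq0 !compA -compBl e.
move=> W a b ab.
have [|g [gE gU]] := u _ (i1 ∘ a + i2 ∘ b).
  rewrite compBl !compDr -!compA !(compA p1) !(compA p2) b1 b2 b3 b4.
  by rewrite !comp1m !comp0m !compm0 addr0 add0r ab subrr.
exists g; split.
  rewrite -!compA gE !compDr !compA b1 b2 b3 b4.
  by rewrite !comp1m !comp0m addr0 add0r.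
move=> g' [g1 g2]; apply: gU.
by rewrite -g1 -g2 !compA -!compDl b5 comp1m.
Qed.

Section SplitSquares.
Variables (U V W T : lmodType S) (i : {linear U -> V}) (p : {linear V -> W}).
Variables (r : {linear V -> U}) (s : {linear W -> V}).
Hypothesis h : splitting i p r s.

Lemma split_pushout (f : {linear U -> T}) :
  splitting (pairing i f)
    (pairing (p \o lfst V T) (lsnd V T \- (f \o r \o lfst V T)))
    (r \o lfst V T) (pairing (s \o lfst W T) (lsnd W T)).
Proof.
split=> [x|[z t]|[y t]] /=.
- exact: (split_ri h).
- by rewrite (split_ps h) (split_rs h) linear0 subr0.
- congr pair => /=; first exact: (split_id h).
  by rewrite addrC subrK.
Qed.

Lemma split_pullback (f : {linear T -> W}) :
  splitting (pairing ((i \o lfst U T) \+ (s \o f \o lsnd U T)) (lsnd U T))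
    ((p \o lfst V T) \- (f \o lsnd V T))
    (pairing (r \o lfst V T) (lsnd V T)) (pairing s \0).
Proof.
split=> [[x t]|z|[y t]] /=.
- by rewrite linearD (split_ri h) (split_rs h) addr0.
- by rewrite linear0 subr0 (split_ps h).
- congr pair => /=; last by rewrite addr0.
  by rewrite (linearB s) -addrA [X in _ + X]addrC subrK (split_id h).
Qed.

Lemma split_mono_in2 : splitting (\- pairing \0 idfun : {linear T -> (V * T)%type})
  (lfst V T) (\- lsnd V T) (pairing idfun \0).
Proof.
split=> [x|z|[y t]] //=; first exact: opprK.
by congr pair; rewrite /= ?oppr0 ?opprK ?add0r ?addr0.
Qed.

Lemma split_epi_snd : splitting (pairing idfun \0)
  (lsnd V T) (lfst V T) (pairing \0 idfun).
Proof.
by split=> [x|z|[y t]] //=; congr pair; rewrite /= ?add0r ?addr0.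
Qed.

End SplitSquares.

Lemma pair_pushout X Y X' (i : @hom Pair X Y) (f : @hom Pair X X') :
  inflation pconf i -> exists Y' (f' : @hom Pair Y Y') (i' : @hom Pair X' Y'),
    is_pushout i f f' i' /\ inflation pconf i'.
Proof.
move=> [Z [p /pair_conf_split[[r1 [s1 h1]] [r0 [s0 h0]]]]].
pose m : @hom Pair X (pair_sum Y X') := pair_in1 Y X' ∘ i + pair_in2 Y X' ∘ f.
have m1 : ph1 m = pairing (ph1 i) (ph1 f).
  by apply: linear_ext => x /=; congr pair; rewrite /= ?addr0 ?add0r.
have m0 : ph0 m = pairing (ph0 i) (ph0 f).
  by apply: linear_ext => x /=; congr pair; rewrite /= ?addr0 ?add0r.
have k1 := split_pushout h1 (ph1 f); have k0 := split_pushout h0 (ph0 f).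
rewrite -m1 in k1; rewrite -m0 in k0.
pose C1 := fgproj_prod (pair_P1 Z) (pair_P1 X').
pose C0 := fgproj_prod (pair_P0 Z) (pair_P0 X').
pose c := @coker_pair_map _ _ m C1 C0 _ _ _ _ _ _ k1 k0.
have cc := @coker_pair_conf _ _ m C1 C0 _ _ _ _ _ _ k1 k0.
exists _, (c ∘ pair_in1 Y X'), (- (c ∘ pair_in2 Y X')); split.
  apply: pushout_of_cokernel (pair_biproduct Y X') _.
  exact: pair_cokernel cc.
apply/pair_inflE; split.
- exists (pair_P1 Z), (lfst _ _), (\- lsnd _ _), (pairing idfun \0).
  have -> : ph1 (- (c ∘ pair_in2 Y X')) =
      \- pairing (\0 : {linear _ -> pair_P1 Z}) idfun.
    apply: linear_ext => x; congr (- _); congr pair => /=.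
      exact: linear0.
    by rewrite !linear0 addr0.
  exact: (@split_mono_in2 _ _).
- exists (pair_P0 Z), (lfst _ _), (\- lsnd _ _), (pairing idfun \0).
  have -> : ph0 (- (c ∘ pair_in2 Y X')) =
      \- pairing (\0 : {linear _ -> pair_P0 Z}) idfun.
    apply: linear_ext => x; congr (- _); congr pair => /=.
      exact: linear0.
    by rewrite !linear0 addr0.
  exact: (@split_mono_in2 _ _).
Qed.

Lemma pair_pullback Y Z Z' (p : @hom Pair Y Z) (f : @hom Pair Z' Z) :
  deflation pconf p -> exists Y' (f' : @hom Pair Y' Y) (p' : @hom Pair Y' Z'),
    is_pullback p f f' p' /\ deflation pconf p'.
Proof.
move=> [X [i /pair_conf_split[[r1 [s1 h1]] [r0 [s0 h0]]]]].
pose m : @hom Pair (pair_sum Y Z') Z := p ∘ pair_pr1 Y Z' - f ∘ pair_pr2 Y Z'.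
have k1 := split_pullback h1 (ph1 f); have k0 := split_pullback h0 (ph0 f).
have m1 : ph1 m = (ph1 p \o lfst _ _) \- (ph1 f \o lsnd _ _).
  exact: linear_ext.
have m0 : ph0 m = (ph0 p \o lfst _ _) \- (ph0 f \o lsnd _ _).
  exact: linear_ext.
rewrite -m1 in k1; rewrite -m0 in k0.
pose K1 := fgproj_prod (pair_P1 X) (pair_P1 Z').
pose K0 := fgproj_prod (pair_P0 X) (pair_P0 Z').
pose k := @ker_pair_map _ _ m K1 K0 _ _ _ _ _ _ k1 k0.
have cc := @ker_pair_conf _ _ m K1 K0 _ _ _ _ _ _ k1 k0.
exists _, (pair_pr1 Y Z' ∘ k), (pair_pr2 Y Z' ∘ k); split.
  apply: pullback_of_kernel (pair_biproduct Y Z') _.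
  exact: pair_kernel cc.
apply/pair_deflE; split.
- exists (pair_P1 X), (pairing idfun \0), (lfst _ _), (pairing \0 idfun).
  have -> : ph1 (pair_pr2 Y Z' ∘ k) = lsnd (pair_P1 X) (pair_P1 Z').
    exact: linear_ext.
  exact: (@split_epi_snd _ _).
- exists (pair_P0 X), (pairing idfun \0), (lfst _ _), (pairing \0 idfun).
  have -> : ph0 (pair_pr2 Y Z' ∘ k) = lsnd (pair_P0 X) (pair_P0 Z').
    exact: linear_ext.
  exact: (@split_epi_snd _ _).
Qed.

Lemma pair_exact : exact_structure pconf.
Proof.
split.
- exact: pair_kernel.
- exact: pair_cokernel.
- exact: pair_conf_iso.
- by move=> X; apply/pair_inflE; split; apply: split_mono_id.
- by move=> X; apply/pair_deflE; split; apply: split_epi_id.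
- move=> X Y Z i j /pair_inflE[i1 i0] /pair_inflE[j1 j0]; apply/pair_inflE.
  by split; apply: split_mono_comp.
- move=> X Y Z i j /pair_deflE[i1 i0] /pair_deflE[j1 j0]; apply/pair_deflE.
  by split; apply: split_epi_comp.
- exact: pair_pushout.
- exact: pair_pullback.
Qed.

(* the sum of (1 : P -> P, omega : P -> P) and (omega : Q -> Q, 1 : Q -> Q) *)

Section Trivial.
Variables P Q : fgproj S.

Lemma scale_linear (U : lmodType S) : linear (fun x : U => omega *: x).
Proof. by move=> a x y; rewrite scalerDr !scalerA mulrC. Qed.
Definition scale_lin (U : lmodType S) : {linear U -> U} :=
  mklin (@scale_linear U).

Definition trivial_pair : Pair.
Proof.
apply: (@PairObj _ omega (fgproj_prod P Q) (fgproj_prod P Q)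
  (pairing (lfst P Q) (scale_lin Q \o lsnd P Q))
  (pairing (scale_lin P \o lfst P Q) (lsnd P Q))) => -[x y] /=; exact: erefl.
Defined.

Lemma trivial_projective : projective_object pconf trivial_pair.
Proof.
move=> Y Z p f /pair_deflE[[K1 [i1 [r1 [s1 h1]]]] [K0 [i0 [r0 [s0 h0]]]]].
pose al : {linear P -> pair_P1 Y} := s1 \o (ph1 f \o pairing idfun \0).
pose be : {linear Q -> pair_P0 Y} := s0 \o (ph0 f \o pairing \0 idfun).
have g1 x : copairing al (rho0 Y \o be) (rho0 trivial_pair x) =
    rho0 Y (copairing (rho1 Y \o al) be x).
  by case: x => a b /=; rewrite (linearD (rho0 Y)) rho01 -!scal_lin;
    congr (s1 (ph1 f _) + _); congr pair; rewrite /= scaler0.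
have g0 x : rho1 Y (copairing al (rho0 Y \o be) x) =
    copairing (rho1 Y \o al) be (rho1 trivial_pair x).
  by case: x => a b /=; rewrite (linearD (rho1 Y)) rho10 -!scal_lin;
    congr (_ + s0 (ph0 f _)); congr pair; rewrite /= scaler0.
exists (PairHom g1 g0); apply: pair_hom_ext => -[a b] /=.
- rewrite linearD (split_ps h1) (ph1E p) (split_ps h0) -(ph1E f) -linearD.
  by congr (ph1 f _); congr pair; rewrite /= ?scaler0 ?addr0 ?add0r.
- rewrite linearD -(ph0E p) (split_ps h1) (split_ps h0) (ph0E f) -linearD.
  by congr (ph0 f _); congr pair; rewrite /= ?scaler0 ?addr0 ?add0r.
Qed.

Lemma trivial_injective : injective_object pconf trivial_pair.
Proof.
move=> X Y i f /pair_inflE[[K1 [p1 [r1 [s1 h1]]]] [K0 [p0 [r0 [s0 h0]]]]].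
pose al : {linear pair_P0 Y -> P} := lfst P Q \o (ph0 f \o r0).
pose be : {linear pair_P1 Y -> Q} := lsnd P Q \o (ph1 f \o r1).
have g1 x : pairing (al \o rho1 Y) be (rho0 Y x) =
    rho0 trivial_pair (pairing al (be \o rho0 Y) x).
  by congr pair; rewrite /= rho10 !scal_lin.
have g0 x : rho1 trivial_pair (pairing (al \o rho1 Y) be x) =
    pairing al (be \o rho0 Y) (rho1 Y x).
  by congr pair; rewrite /= rho01 !scal_lin.
exists (@PairHom _ _ Y trivial_pair _ _ g1 g0); apply: pair_hom_ext => x /=.
- rewrite (ph0E i) (split_ri h0) (split_ri h1) -(ph0E f) /=.
  by case: (ph1 f x).
- rewrite -(ph1E i) (split_ri h0) (split_ri h1) (ph1E f) /=.
  by case: (ph0 f x).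
Qed.

End Trivial.

Lemma pair_enough_projectives X : exists P (p : @hom Pair P X),
  [/\ projective_object pconf P, injective_object pconf P & deflation pconf p].
Proof.
pose T := trivial_pair (pair_P1 X) (pair_P0 X).
have g1 x : copairing idfun (rho0 X) (rho0 T x) =
    rho0 X (copairing (rho1 X) idfun x).
  by case: x => a b /=; rewrite (linearD (rho0 X)) rho01.
have g0 x : rho1 X (copairing idfun (rho0 X) x) =
    copairing (rho1 X) idfun (rho1 T x).
  by case: x => a b /=; rewrite (linearD (rho1 X)) rho10.
exists T, (@PairHom _ _ T X _ _ g1 g0); split.
- exact: trivial_projective.
- exact: trivial_injective.
apply/pair_deflE; split=> /=.
- exists (pair_P0 X), (pairing (\- rho0 X) idfun), (lsnd _ _), (pairing idfun \0).
  split=> [x|z|[x z]] //=; first by rewrite linear0 addr0.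
  by congr pair; rewrite /= ?addr0 // addrC addrK.
- exists (pair_P1 X), (pairing idfun (\- rho1 X)), (lfst _ _), (pairing \0 idfun).
  split=> [x|z|[x z]] //=; first by rewrite linear0 add0r.
  by congr pair; rewrite /= ?addr0 // addKr.
Qed.

Lemma pair_enough_injectives X : exists I (i : @hom Pair X I),
  [/\ projective_object pconf I, injective_object pconf I & inflation pconf i].
Proof.
pose T := trivial_pair (pair_P0 X) (pair_P1 X).
have g1 x : pairing (rho1 X) idfun (rho0 X x) =
    rho0 T (pairing idfun (rho0 X) x).
  by congr pair; rewrite /= rho10.
have g0 x : rho1 T (pairing (rho1 X) idfun x) =
    pairing idfun (rho0 X) (rho1 X x).
  by congr pair; rewrite /= rho01.
exists T, (@PairHom _ _ X T _ _ g1 g0); split.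
- exact: trivial_projective.
- exact: trivial_injective.
apply/pair_inflE; split=> /=.
- exists (pair_P0 X), (lfst _ _ \- (rho1 X \o lsnd _ _)), (lsnd _ _), (pairing idfun \0).
  split=> [x|z|[x z]] //=; first by rewrite linear0 subr0.
  by congr pair; rewrite /= ?addr0 // addrC subrK.
- exists (pair_P1 X), (lsnd _ _ \- (rho0 X \o lfst _ _)), (lfst _ _), (pairing \0 idfun).
  split=> [x|z|[x z]] //=; first by rewrite linear0 subr0.
  by congr pair; rewrite /= ?addr0 // addrC subrK.
Qed.

Lemma pair_frobenius : frobenius_structure pconf.
Proof.
apply: frobenius_structure_of_enough.
- exact: pair_additive.
- exact: pair_exact.
- exact: pair_enough_projectives.
- exact: pair_enough_injectives.
Qed.

End PairFrobenius.
Section MonFrobenius.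
Variables (S : comNzRingType) (omega : S).
Local Notation Mon := (mon_preadditive omega).
Local Notation Pair := (pair_preadditive omega).

Lemma fgproj_torsion_free (P : fgproj S) (x : P) :
  GRing.lreg omega -> omega *: x = 0 -> x = 0.
Proof.
move=> reg; have [n [g gE]] := @fgp_fg _ P.
have lg : linear (fun c : 'rV[S]_n => \sum_i c 0 i *: g i).
  move=> a c d; rewrite scaler_sumr -big_split; apply: eq_bigr => i _ /=.
  by rewrite !mxE scalerDl scalerA.
have [y|s sE] := @fgp_proj _ P _ _ (mklin lg) idfun.
  have [c ->] := gE y; exists (\row_i c i) => /=.
  by apply: eq_bigr => i _; rewrite mxE.
move=> e; rewrite -[x]sE; suff -> : s x = 0 by exact: linear0.
apply/rowP => i; rewrite mxE; apply: reg.
have : (omega *: s x) 0 i = 0 by rewrite -scal_lin e linear0 mxE.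
by rewrite mxE mulr0.
Qed.

Section Inverse.
Variable X : Mon.

Definition mon_inv_fun (y : mon_tgt X) : mon_src X :=
  projT1 (cid (mon_coker (m := X) y)).

Lemma mon_inv_funK y : mon_map X (mon_inv_fun y) = omega *: y.
Proof. by rewrite /mon_inv_fun; case: cid. Qed.

Lemma mon_inv_linear : linear mon_inv_fun.
Proof.
move=> a x y; apply: (@mon_mono _ _ X).
rewrite (linearP (mon_map X)) !mon_inv_funK scalerDr !scalerA.
by rewrite (mulrC a).
Qed.

Definition mon_inv : {linear mon_tgt X -> mon_src X} := mklin mon_inv_linear.

Lemma mon_invK y : mon_map X (mon_inv y) = omega *: y.
Proof. exact: mon_inv_funK. Qed.

Lemma mon_mapK x : mon_inv (mon_map X x) = omega *: x.
Proof. by apply: (@mon_mono _ _ X); rewrite mon_invK scal_lin. Qed.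

Definition mon_pair : Pair := PairObj mon_mapK mon_invK.
End Inverse.

Definition mon_pair_map X Y (f : @hom Mon X Y) :
  @hom Pair (mon_pair X) (mon_pair Y).
Proof.
exists (mh1 f) (mh0 f) => x.
- apply: (@mon_mono _ _ Y).
  by rewrite mon_invK -(mhE f) /= mon_invK scal_lin.
- exact/esym/mhE.
Defined.

Definition mon_pair_functor : additive_functor Mon Pair.
Proof.
refine (@AdditiveFunctor Mon Pair mon_pair mon_pair_map _ _ _).
- by move=> X; apply: pair_hom_ext.
- by move=> X Y Z g f; apply: pair_hom_ext.
- by move=> X Y f g; apply: pair_hom_ext.
Defined.

Lemma mon_frobenius : GRing.lreg omega ->
  frobenius_structure (@mon_conflation S omega).
Proof.
move=> reg.
apply: (transfer_frobenius (F := mon_pair_functor) _ _ _ _ (pair_frobenius omega)).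
- move=> X Y h; have e x : ph0 h (mon_map X x) = mon_map Y (ph1 h x).
    exact/esym/(ph0E h).
  by exists (MonHom e); apply: pair_hom_ext.
- move=> X Y f g e; apply: mon_hom_ext => x.
    exact: (pair_homP1 e).
  exact: (pair_homP0 e).
- move=> Y.
  have inj : injective (rho1 Y).
    move=> x y e; apply/eqP; rewrite -subr_eq0; apply/eqP.
    apply: (fgproj_torsion_free reg).
    by rewrite -rho01 linearB e subrr linear0.
  have cok y : exists x, rho1 Y x = omega *: y.
    by exists (rho0 Y y); rewrite rho10.
  pose X : Mon := MonObj inj cok.
  have e x : mon_inv X x = rho0 Y x.
    by apply: (inj); rewrite rho10 (mon_invK (X := X)).
  have a1 x : (idfun : {linear _ -> pair_P1 Y}) (rho0 (mon_pair X) x) =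
    rho0 Y ((idfun : {linear _ -> pair_P0 Y}) x) by exact: e.
  have a0 x : rho1 Y ((idfun : {linear _ -> pair_P1 Y}) x) =
    (idfun : {linear _ -> pair_P0 Y}) (rho1 (mon_pair X) x) by [].
  have b1 x : (idfun : {linear _ -> pair_P1 Y}) (rho0 Y x) =
    rho0 (mon_pair X) ((idfun : {linear _ -> pair_P0 Y}) x) by exact/esym/e.
  have b0 x : rho1 (mon_pair X) ((idfun : {linear _ -> pair_P1 Y}) x) =
    (idfun : {linear _ -> pair_P0 Y}) (rho1 Y x) by [].
  exists X, (@PairHom _ _ (mon_pair X) Y idfun idfun a1 a0).
  exists (@PairHom _ _ Y (mon_pair X) idfun idfun b1 b0).
  by split; apply: pair_hom_ext.
- by [].
Qed.

End MonFrobenius.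

(* The regularity of omega is what makes Mon Frobenius: it is needed for
   omega : P -> P to be an object. *)
Definition Mon (S : comNzRingType) (omega : S) (reg : GRing.lreg omega) :
  frobenius_category := FrobeniusCategory (mon_frobenius reg).

Definition Pair (S : comNzRingType) (omega : S) : frobenius_category :=
  FrobeniusCategory (pair_frobenius omega).

(* Main.v *)
(* Sending a monomorphism f with omega Coker f = 0 to the pair (f, g), g being
   the unique map with f g = omega, is an equivalence Mon -> Pair which
   preserves and reflects conflations.  Such an equivalence preserves and
   reflects projectives, hence descends to an equivalence of stable categories.
   Two conflations X -> I -> C with I injective have stably isomorphic cokernel
   terms, compatibly with their pushouts along any X -> Y: this gives the
   commutation with the shift and the preservation of distinguished triangles. *)
From mathcomp Require Import all_boot all_algebra.
From mathcomp Require Import boolp.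
Require Import Defs.

Set Implicit Arguments.
Unset Strict Implicit.
Unset Printing Implicit Defensive.

Import GRing.Theory.
Local Open Scope ring_scope.

(** * Composites of isomorphisms and uniqueness of induced maps *)

Section Preadditive.
Variable C : preadditive.

Lemma is_iso_comp (X Y Z : C) (g : hom Y Z) (f : hom X Y) :
  is_iso g -> is_iso f -> is_iso (g ∘ f).
Proof.
move=> [g' [g1 g2]] [f' [f1 f2]]; exists (f' ∘ g'); split.
- by rewrite -compA (compA g') g1 comp1m f1.
- by rewrite -compA (compA f) f2 comp1m g2.
Qed.

Lemma pushout_hom_ext (X Y X' Y' W : C) (i : hom X Y) (f : hom X X')
    (f' : hom Y Y') (i' : hom X' Y') (c d : hom Y' W) :
  is_pushout i f f' i' -> c ∘ f' = d ∘ f' -> c ∘ i' = d ∘ i' -> c = d.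
Proof.
move=> [sq u] e1 e2.
have [|k [_ kU]] := u _ (d ∘ f') (d ∘ i'); first by rewrite -!compA sq.
by rewrite -(kU c) // -(kU d).
Qed.

Lemma cokernel_hom_ext (X Y Z W : C) (i : hom X Y) (p : hom Y Z)
    (c d : hom Z W) :
  is_cokernel i p -> c ∘ p = d ∘ p -> c = d.
Proof.
move=> [e u] cd.
have [|k [_ kU]] := u _ (d ∘ p); first by rewrite -compA e compm0.
by rewrite -(kU c) // -(kU d).
Qed.

End Preadditive.

(** * Fully faithful, essentially surjective functors are equivalences *)

Section EquivalenceCriterion.
Variables (C D : preadditive) (F : additive_functor C D).
Hypothesis full : forall X Y (h : hom (F X) (F Y)), exists f, fmap F f = h.
Hypothesis faithful : forall X Y (f g : hom X Y), fmap F f = fmap F g -> f = g.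
Hypothesis ess : forall Y : D, exists X (e : hom (F X) Y), is_iso e.

(** Choice gives each [Y] a preimage with an isomorphism [e Y]. Conjugating by these and lifting by
    fullness defines the quasi-inverse on maps; faithfulness yields its functor laws. *)
Lemma fully_faithful_equivalence : is_equivalence F.
Proof.
pose GX Y : C := projT1 (cid (ess Y)).
have exE Y : exists e : hom (F (GX Y)) Y * hom Y (F (GX Y)),
    e.2 ∘ e.1 = idm _ /\ e.1 ∘ e.2 = idm _.
  by rewrite /GX; case: cid => X [e [e' h]]; exists (e, e').
pose e Y := (projT1 (cid (exE Y))).1; pose e' Y := (projT1 (cid (exE Y))).2.
have e'e Y : e' Y ∘ e Y = idm _ by rewrite /e /e'; case: cid => ? [].
have ee' Y : e Y ∘ e' Y = idm _ by rewrite /e /e'; case: cid => ? [].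
pose Gm Y Z (f : hom Y Z) := projT1 (cid (full (e' Z ∘ f ∘ e Y))).
have GmE Y Z (f : hom Y Z) : fmap F (Gm Y Z f) = e' Z ∘ f ∘ e Y.
  by rewrite /Gm; case: cid.
have G1 Y : Gm _ _ (idm Y) = idm (GX Y).
  by apply: faithful; rewrite GmE compm1 e'e fmap1.
have GM X Y Z (g : hom Y Z) (f : hom X Y) :
    Gm _ _ (g ∘ f) = Gm _ _ g ∘ Gm _ _ f.
  apply: faithful; rewrite fmapM !GmE -!compA; congr (_ ∘ _); congr (_ ∘ _).
  by rewrite !compA ee' comp1m.
have GD X Y (f g : hom X Y) : Gm _ _ (f + g) = Gm _ _ f + Gm _ _ g.
  by apply: faithful; rewrite fmapD !GmE compDr compDl.
exists (AdditiveFunctor G1 GM GD); split.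
(* The first natural isomorphism is the lift along [F] of [e (F X)]. *)
- pose a X := projT1 (cid (full (e (F X)))).
  have aE X : fmap F (a X) = e (F X) by rewrite /a; case: cid.
  exists a; split=> [X|X Y f].
    have [b bE] := full (e' (F X)).
    by exists b; split; apply: faithful; rewrite fmapM aE bE fmap1 ?e'e ?ee'.
  by apply: faithful; rewrite !fmapM !aE /= GmE -compA compA ee' comp1m.
- exists e; split=> [Y|Y Z f /=]; first exact: (ex_intro _ (e' Y) (conj (e'e Y) (ee' Y))).
  by rewrite GmE -compA compA ee' comp1m.
Qed.

End EquivalenceCriterion.

(** * Maps induced on cosyzygies, up to stable equality *)

Section StableCategory.
Variable A : frobenius_category.
Local Notation stable := (stable_category A).
Local Notation projective := (projective_object (@conflation A)).
Local Notation injective := (injective_object (@conflation A)).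
Let exA := frobenius_exact (frobeniusP A).

Lemma stable_mor_surj (X Y : stable) (f : hom X Y) :
  exists f0 : @hom A X Y, f = stable_mor f0.
Proof. by exists (stable_rep f); rewrite /stable_mor stable_repK. Qed.

Lemma stable_morM (X Y Z : A) (g : hom Y Z) (f : hom X Y) :
  stable_mor (g ∘ f) = stable_mor g ∘ stable_mor f.
Proof. exact/esym/stab_comp. Qed.

Lemma stable_morP (X Y : A) (f g : hom X Y) :
  stable_mor f = stable_mor g <-> stably_zero (f - g).
Proof. exact: stabP. Qed.

Lemma stable_mor_iso (X Y : A) (f : hom X Y) (g : hom Y X) :
  stably_zero (g ∘ f - idm X) -> stably_zero (f ∘ g - idm Y) ->
  is_iso (stable_mor f).
Proof.
by move=> /stabP h1 /stabP h2; exists (stable_mor g); rewrite -!stable_morM.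
Qed.

Lemma is_iso_stable_mor (X Y : A) (f : hom X Y) :
  is_iso f -> is_iso (stable_mor f).
Proof.
by case=> g [e1 e2]; exists (stable_mor g); rewrite -!stable_morM e1 e2.
Qed.

(* [f] extends to [h], which induces [g] on the cokernels:
     X --i--> I --p--> C
     |f       |h       |g
     Y --j--> J --q--> D                                                    *)
Definition ladder (X I C Y J D : A) (i : hom X I) (p : hom I C)
    (j : hom Y J) (q : hom J D) (f : hom X Y) (h : hom I J) (g : hom C D) :=
  h ∘ i = j ∘ f /\ g ∘ p = q ∘ h.

Section Ladders.
Variables (X I C : A) (i : hom X I) (p : hom I C).
Hypothesis ip : conflation i p.

Lemma ladder_exists (Y J D : A) (j : hom Y J) (q : hom J D) (f : hom X Y) :
  conflation j q -> injective J -> exists h g, ladder i p j q f h g.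
Proof.
move=> jq injJ.
have [|h hE] := injJ _ _ i (j ∘ f); first by exists C, p.
have [_ /(_ _ (q ∘ h)) []] := conf_cokernel exA ip.
  by rewrite -compA hE compA (conf_kernel exA jq).1 comp0m.
by move=> g [gE _]; exists h, g.
Qed.

(** Since [h] kills [i], it is [k ∘ p] for some [k], so [g = q ∘ k] factors through [J], which is
    projective because it is injective. *)
Lemma ladder_stably_zero (Y J D : A) (j : hom Y J) (q : hom J D)
    (h : hom I J) (g : hom C D) :
  q ∘ j = 0 -> injective J -> ladder i p j q 0 h g -> stably_zero g.
Proof.
move=> qj injJ [e1 e2].
have [_ /(_ _ h) []] := conf_cokernel exA ip; first by rewrite e1 compm0.
move=> k [kE _]; exists J, k, q; split.
  exact/(projective_injective (frobeniusP A)).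
by apply: (cokernel_hom_ext (conf_cokernel exA ip)); rewrite e2 -compA kE.
Qed.

(** The difference of two ladders over [f] is a ladder over [0]. *)
Lemma ladder_stable_eq (Y J D : A) (j : hom Y J) (q : hom J D)
    (f : hom X Y) (h h' : hom I J) (g g' : hom C D) :
  conflation j q -> injective J ->
  ladder i p j q f h g -> ladder i p j q f h' g' ->
  stable_mor g = stable_mor g'.
Proof.
move=> jq injJ [e1 e2] [e1' e2']; apply/stable_morP.
apply: (ladder_stably_zero (conf_kernel exA jq).1 injJ (h := h - h')).
by split; rewrite compBl ?compBr ?e1 ?e2 ?e1' ?e2' ?subrr ?compm0.
Qed.

End Ladders.

Lemma ladder_id (X I C : A) (i : hom X I) (p : hom I C) :
  ladder i p i p (idm X) (idm I) (idm C).
Proof. by split; rewrite comp1m compm1. Qed.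

Lemma ladder_comp (X I C Y J D Z K E : A) (i : hom X I) (p : hom I C)
    (j : hom Y J) (q : hom J D) (k : hom Z K) (r : hom K E)
    (f : hom X Y) h g (f' : hom Y Z) h' g' :
  ladder i p j q f h g -> ladder j q k r f' h' g' ->
  ladder i p k r (f' ∘ f) (h' ∘ h) (g' ∘ g).
Proof.
move=> [e1 e2] [e1' e2']; split.
- by rewrite -compA e1 !compA e1'.
- by rewrite -compA e2 !compA e2'.
Qed.

(** A form of the dual of Schanuel's lemma: ladders over [idm X] exist in both directions, and their
    composites are stably equal to the identity ladders. *)
Lemma ladder_iso (X I C J D : A) (i : hom X I) (p : hom I C)
    (j : hom X J) (q : hom J D) h g :
  conflation i p -> conflation j q -> injective I -> injective J ->
  ladder i p j q (idm X) h g -> is_iso (stable_mor g).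
Proof.
move=> ip jq injI injJ l.
have [h' [g' l']] := ladder_exists jq (idm X) ip injI.
apply: (@stable_mor_iso _ _ g g'); apply/stable_morP.
- apply: (ladder_stable_eq ip ip injI) (ladder_id i p).
  by have := ladder_comp l l'; rewrite compm1; apply.
- apply: (ladder_stable_eq jq jq injJ) (ladder_id j q).
  by have := ladder_comp l' l; rewrite compm1; apply.
Qed.

(** * Cones built from different injective embeddings *)

Section PushoutLadder.
Variables (X Y : A) (u : hom X Y).

(* the pushout of a conflation along [u]:
     X --i--> I --p--> C
     |u       |b       ||
     Y --v--> Z --w--> C                                                    *)
Definition cone_square (I C Z : A) (i : hom X I) (p : hom I C)
    (b : hom I Z) (v : hom Y Z) (w : hom Z C) :=
  [/\ is_pushout i u b v, w ∘ v = 0 & w ∘ b = p].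

Lemma cone_square_exists (I C : A) (i : hom X I) (p : hom I C) :
  conflation i p -> exists Z b v w, @cone_square I C Z i p b v w.
Proof.
move=> ip; have [|Z [b [v [po _]]]] := inflation_pushout exA u (i := i).
  by exists C, p.
(* [w] is induced by [p] on [I] and [0] on [Y], compatible as [p ∘ i = 0]. *)
have [_ /(_ _ p 0) []] := po.
  by rewrite comp0m (conf_kernel exA ip).1.
by move=> w [[w1 w2] _]; exists Z, b, v, w.
Qed.

Lemma cone_comparison (I C Z J D Z' : A) (i : hom X I) (p : hom I C)
    (b : hom I Z) (v : hom Y Z) (w : hom Z C) (j : hom X J) (q : hom J D)
    (b' : hom J Z') (v' : hom Y Z') (w' : hom Z' D) h g :
  cone_square i p b v w -> cone_square j q b' v' w' ->
  ladder i p j q (idm X) h g ->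
  exists c, [/\ c ∘ v = v', c ∘ b = b' ∘ h & w' ∘ c = g ∘ w].
Proof.
move=> [po wv wb] [[sq' _] wv' wb'] [e1 e2].
have [_ /(_ _ (b' ∘ h) v') []] := po.
  by rewrite -compA e1 compm1.
move=> c [[c1 c2] _]; exists c; split=> //.
apply: (pushout_hom_ext po).
- by rewrite -!compA c1 wb e2 compA wb'.
- by rewrite -!compA c2 wv wv' compm0.
Qed.

(* An endomorphism of the cone over [Y] differs from the identity by a map
   that factors through [b : I -> Z]. *)
Lemma cone_endo_stable_id (I C Z : A) (i : hom X I) (p : hom I C)
    (b : hom I Z) (v : hom Y Z) (w : hom Z C) (h : hom I I) (c : hom Z Z) :
  conflation i p -> injective I -> cone_square i p b v w ->
  h ∘ i = i -> c ∘ v = v -> c ∘ b = b ∘ h -> stably_zero (c - idm Z).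
Proof.
move=> ip injI [po wv wb] hi cv cb.
have [_ /(_ _ (h - idm I)) []] := conf_cokernel exA ip.
  by rewrite compBl comp1m hi subrr.
move=> k [kE _]; exists I, (k ∘ w), b; split.
  exact/(projective_injective (frobeniusP A)).
apply: (pushout_hom_ext po).
- by rewrite -!compA wb kE compBl compBr cb comp1m compm1.
- by rewrite -!compA wv !compm0 compBl cv comp1m subrr.
Qed.

(** Ladders over [idm X] in both directions induce maps of cones whose composites fix [v] and [v'];
    by [cone_endo_stable_id] these are stably identities. *)
Lemma cone_comparison_iso (I C Z J D Z' : A) (i : hom X I) (p : hom I C)
    (b : hom I Z) (v : hom Y Z) (w : hom Z C) (j : hom X J) (q : hom J D)
    (b' : hom J Z') (v' : hom Y Z') (w' : hom Z' D) h g :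
  conflation i p -> conflation j q -> injective I -> injective J ->
  cone_square i p b v w -> cone_square j q b' v' w' ->
  ladder i p j q (idm X) h g ->
  exists c, [/\ is_iso (stable_mor c), c ∘ v = v' & w' ∘ c = g ∘ w].
Proof.
move=> ip jq injI injJ s s' l.
have [h' [g' l']] := ladder_exists jq (idm X) ip injI.
have [c [c1 c2 c3]] := cone_comparison s s' l.
have [d [d1 d2 d3]] := cone_comparison s' s l'.
exists c; split=> //.
case: l l' => l1 _ [l1' _]; apply: (@stable_mor_iso _ _ c d).
- apply: (cone_endo_stable_id (h := h' ∘ h) ip injI s).
  + by rewrite -compA l1 compA l1' !compm1.
  + by rewrite -compA c1 d1.
  + by rewrite -compA c2 !compA d2.
- apply: (cone_endo_stable_id (h := h ∘ h') jq injJ s').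
  + by rewrite -compA l1' compA l1 !compm1.
  + by rewrite -compA d1 c1.
  + by rewrite -compA d2 !compA c2.
Qed.

End PushoutLadder.
End StableCategory.

(** * An equivalence that preserves and reflects conflations, made stable *)

Section ExactEquivalence.
Variables (A B : frobenius_category) (F : additive_functor A B).
Hypothesis full : forall X Y (h : hom (F X) (F Y)), exists f, fmap F f = h.
Hypothesis faithful : forall X Y (f g : hom X Y), fmap F f = fmap F g -> f = g.
Hypothesis ess : forall Y : B, exists X (e : hom (F X) Y), is_iso e.
Hypothesis confE : forall (X Y Z : A) (i : hom X Y) (p : hom Y Z),
  conflation i p <-> conflation (fmap F i) (fmap F p).

(** For the forward direction, a projective cover of [F X] by a deflation is moved to some [F P']
    and pulled back to a deflation onto [X]. It splits, so [F X] is a retract of [F P']. *)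
Lemma fmap_projective X : projective_object (@conflation A) X <->
  projective_object (@conflation B) (F X).
Proof.
have frobB := frobeniusP B.
split=> [pX|]; last exact: (transfer_projective full faithful ess confE frobB).
have [P [p [pP dp]]] := enough_projectives frobB (F X).
have [P' [p' [e [e' [h1 h2 pE]]]]] := ess_in full ess p.
have pFP : projective_object (@conflation B) (F P').
  exact: projective_retract h1 pP.
have [|s sE] := pX _ _ p' (idm X).
  apply/(deflE full ess confE frobB); rewrite pE.
  apply: (deflation_comp (frobenius_exact frobB)) => //.
  (* The isomorphism [e] is a deflation: transport along [e'] a conflation ending in [idm P]. *)
  have [Y [i ip]] := deflation_id (frobenius_exact frobB) P.
  exists Y, (e' ∘ i); move: ip.
  apply: (conf_iso (frobenius_exact frobB) (iso_id _) (b := e') _ (iso_id _)).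
  - by exists e.
  - by rewrite compm1.
  - by rewrite comp1m h2.
by apply: (projective_retract (a := fmap F s) (b := fmap F p')) pFP;
  rewrite -fmapM sE fmap1.
Qed.

Lemma fmap_injective X : injective_object (@conflation A) X ->
  injective_object (@conflation B) (F X).
Proof.
move=> /(projective_injective (frobeniusP A)) /fmap_projective.
by move/(projective_injective (frobeniusP B)).
Qed.

(** For reflection, the projective in the factorization is replaced by an isomorphic [F P'], and
    both factors lift by fullness. *)
Lemma fmap_stably_zero X Y (f : hom X Y) :
  stably_zero f <-> stably_zero (fmap F f).
Proof.
split=> [[P [a [b [pP ->]]]]|[P [a [b [pP fE]]]]].
  by exists (F P), (fmap F a), (fmap F b); rewrite fmapM -fmap_projective.
have [P' [a' [e [e' [h1 h2 aE]]]]] := ess_out full ess a.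
have [b' bE] := full (b ∘ e).
exists P', a', b'; split.
  by apply/fmap_projective; exact: projective_retract h1 pP.
by apply: faithful; rewrite fE fmapM aE bE -compA (compA e) h2 comp1m.
Qed.

(** An isomorphism moves the test object [W] into the image of [F], where the test maps lift to
    [A]. *)
Lemma fmap_pushout X Y X' Y' (i : hom X Y) (f : hom X X')
    (f' : hom Y Y') (i' : hom X' Y') :
  is_pushout i f f' i' ->
  is_pushout (fmap F i) (fmap F f) (fmap F f') (fmap F i').
Proof.
move=> [sq u]; split; first by rewrite -!fmapM sq.
move=> W a b ab; have [W' [a' [e [e' [h1 h2 aE]]]]] := ess_out full ess a.
have [b' bE] := full (e' ∘ b).
have [|c [[c1 c2] cU]] := u _ a' b'.
  by apply: faithful; rewrite !fmapM aE bE -!compA ab.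
exists (e ∘ fmap F c); split.
  by rewrite -!compA -!fmapM c1 c2 aE bE !compA h2 !comp1m.
move=> d [d1 d2]; have [d' dE] := full (e' ∘ d).
rewrite (cU d'); first by rewrite dE compA h2 comp1m.
by split; apply: faithful; rewrite fmapM dE -compA ?d1 ?d2.
Qed.

Definition stable_map (X Y : stable_category A) (f : hom X Y) :
  @hom (stable_category B) (F X) (F Y) := stable_mor (fmap F (stable_rep f)).

Lemma fmapB X Y (f g : hom X Y) : fmap F (f - g) = fmap F f - fmap F g.
Proof. by apply: (addIr (fmap F g)); rewrite -fmapD !subrK. Qed.

(** One direction makes [stable_map] independent of the representative; the other makes it
    faithful. *)
Lemma fmap_stable_eq (X Y : A) (f g : hom X Y) :
  stable_mor f = stable_mor g <-> stable_mor (fmap F f) = stable_mor (fmap F g).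
Proof. by rewrite !stable_morP -fmapB fmap_stably_zero. Qed.

Lemma stable_mapE (X Y : A) (f : hom X Y) :
  stable_map (stable_mor f) = stable_mor (fmap F f).
Proof. by apply/fmap_stable_eq; apply: stable_repK. Qed.

Definition stable_functor :
  additive_functor (stable_category A) (stable_category B).
Proof.
refine (@AdditiveFunctor (stable_category A) (stable_category B)
  F stable_map _ _ _).
- by move=> X; rewrite [LHS](stable_mapE (@idm A X)) fmap1.
- move=> X Y Z g f.
  have [g0 ->] := stable_mor_surj g; have [f0 ->] := stable_mor_surj f.
  by rewrite -stable_morM !stable_mapE fmapM stable_morM.
- move=> X Y f g.
  have [f0 ->] := stable_mor_surj f; have [g0 ->] := stable_mor_surj g.
  by rewrite -[_ + _](stabD f0 g0) !stable_mapE fmapD [LHS]stabD.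
Defined.

Lemma stable_functor_equivalence : is_equivalence stable_functor.
Proof.
apply: fully_faithful_equivalence.
- move=> X Y h; have [h0 ->] := stable_mor_surj h.
  by have [f <-] := full h0; exists (stable_mor f); apply: stable_mapE.
- move=> X Y f g.
  have [f0 ->] := stable_mor_surj f; have [g0 ->] := stable_mor_surj g.
  by rewrite /= !stable_mapE => /fmap_stable_eq.
- move=> Y; have [X [e ie]] := ess Y.
  by exists X, (stable_mor e); apply: is_iso_stable_mor.
Qed.

(** * Commutation with the shift *)

Section Shift.
Variable X : A.

Lemma fmap_hull_conflation :
  conflation (fmap F (hull_in X)) (fmap F (hull_out X)).
Proof. exact/confE/hull_conflation. Qed.

Lemma fmap_hull_injective :
  injective_object (@conflation B) (F (inj_hull X)).
Proof. exact/fmap_injective/inj_hull_injective. Qed.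

(** The image of the chosen conflation of [X] and the chosen conflation of [F X] both embed [F X] in
    an injective; [g] compares their cokernel terms. *)
Definition shift_ladder (g : hom (F (susp X)) (susp (F X))) := exists h,
  ladder (fmap F (hull_in X)) (fmap F (hull_out X)) (hull_in (F X))
    (hull_out (F X)) (idm (F X)) h g.

Lemma shift_ladder_exists : exists g, shift_ladder g.
Proof.
have [h [g l]] := ladder_exists fmap_hull_conflation (idm (F X))
  (hull_conflation (F X)) (@inj_hull_injective _ (F X)).
by exists g, h.
Qed.

Definition shift_mor : hom (F (susp X)) (susp (F X)) :=
  projT1 (cid shift_ladder_exists).

Lemma shift_morP : shift_ladder shift_mor.
Proof. by rewrite /shift_mor; case: cid. Qed.

Lemma shift_mor_iso : is_iso (stable_mor shift_mor).
Proof.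
have [h l] := shift_morP.
apply: ladder_iso l.
- exact: fmap_hull_conflation.
- exact: hull_conflation.
- exact: fmap_hull_injective.
- exact: inj_hull_injective.
Qed.

End Shift.

(** Both sides of the naturality square come from ladders over [fmap F f0] between the same two
    conflations, so [ladder_stable_eq] applies. *)
Lemma shift_mor_natural : @natural_iso (stable_category A) (stable_category B)
  (comp_functor stable_functor (suspension A))
  (comp_functor (suspension B) stable_functor)
  (fun X => stable_mor (shift_mor X)).
Proof.
split=> [X|X Y f]; first exact: shift_mor_iso.
have [f0 ->] := stable_mor_surj f.
have [g sg] := suspends_exists f0; have [k sk] := suspends_exists (fmap F f0).
have e1 : fmap stable_functor (fmap (suspension A) (stable_mor f0)) =
  stable_mor (fmap F g) by rewrite /= (susp_mapE sg) stable_mapE.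
have e2 : fmap (suspension B) (fmap stable_functor (stable_mor f0)) =
  stable_mor k by rewrite /= stable_mapE (susp_mapE sk).
change (stable_mor (shift_mor Y) ∘
    fmap stable_functor (fmap (suspension A) (stable_mor f0)) =
  fmap (suspension B) (fmap stable_functor (stable_mor f0)) ∘
    stable_mor (shift_mor X)).
rewrite e1 e2 -!stable_morM.
have [h l] := shift_morP X; have [h' l'] := shift_morP Y.
case: sg => m [m1 m2]; case: sk => n sk.
have lF : ladder (fmap F (hull_in X)) (fmap F (hull_out X))
    (fmap F (hull_in Y)) (fmap F (hull_out Y)) (fmap F f0) (fmap F m) (fmap F g).
  by split; rewrite -!fmapM ?m1 ?m2.
have := ladder_comp lF l'; rewrite comp1m => l1.
have := ladder_comp l sk; rewrite compm1 => l2.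
exact: (ladder_stable_eq (fmap_hull_conflation X) (hull_conflation _)
  (@inj_hull_injective _ _) l1 l2).
Qed.

(** The image of a standard triangle is a cone on the image of the chosen conflation of [X']. It is
    replaced by a cone on the chosen conflation of [F X'], stably isomorphic to it. *)
Lemma stable_functor_exact (X Y Z : stable_category A) (u : hom X Y)
    (v : hom Y Z) (w : hom Z (suspension A X)) :
  stable_distinguished u v w ->
  @stable_distinguished B (F X) (F Y) (F Z) (fmap stable_functor u)
    (fmap stable_functor v)
    (stable_mor (shift_mor X) ∘ fmap stable_functor w).
Proof.
move=> [X' [Y' [Z' [u' [v' [w' [[b [po wv wb]]]]]]]]].
move=> [a1 [b1 [c1 [[ia ib ic] [e1 e2 e3]]]]].
have [C [b2 [v2 [w2 s2]]]] :=
  cone_square_exists (fmap F u') (hull_conflation (F X')).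
have s1 : cone_square (fmap F u') (fmap F (hull_in X')) (fmap F (hull_out X'))
    (fmap F b) (fmap F v') (fmap F w').
  split; first exact: fmap_pushout.
    by rewrite -fmapM wv fmap0.
  by rewrite -fmapM wb.
have [h l] := shift_morP X'.
have [c [ic2 cv wc]] := cone_comparison_iso (fmap_hull_conflation X')
  (hull_conflation (F X')) (@fmap_hull_injective X')
  (@inj_hull_injective _ (F X')) s1 s2 l.
exists (F X'), (F Y'), C, (fmap F u'), v2, w2; split.
  by exists b2; case: s2.
(* The third component passes to the image cone by [c1], then to the standard one by [c]. *)
exists (fmap stable_functor a1), (fmap stable_functor b1),
  (stable_mor c ∘ fmap stable_functor c1); split.
  split; [exact: (fmap_is_iso stable_functor ia) |
    exact: (fmap_is_iso stable_functor ib) |].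
  exact: is_iso_comp ic2 (fmap_is_iso stable_functor ic).
have fE (U V : A) (f : hom U V) :
    fmap stable_functor (stable_mor f) = stable_mor (fmap F f).
  exact: stable_mapE.
have [_ nat] := shift_mor_natural.
move/(congr1 (fmap stable_functor)): e1; rewrite !fmapM (fE _ _ u') => e1.
move/(congr1 (fmap stable_functor)): e2; rewrite !fmapM (fE _ _ v') => e2.
move/(congr1 (fmap stable_functor)): e3; rewrite !fmapM (fE _ _ w') => e3.
split; first exact: e1.
(* [etrans] instead of rewriting: objects such as [stable_functor X] and [F X]
   agree only up to conversion *)
- apply: etrans (esym (compA _ _ _)) _; rewrite e2.
  by apply: etrans (compA _ _ _) _; rewrite -(stable_morM c) cv.
(* Naturality at [a1] moves [shift_mor] to the left, [e3] replaces [w] by [w'], and [wc] turns [w']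
   into [w2]. *)
- apply: etrans (compA _ _ _) _.
  apply: etrans (congr1 (fun x => x ∘ _) (esym (nat _ _ a1))) _.
  apply: etrans (esym (compA _ _ _)) _.
  apply: etrans (congr1 (fun x => _ ∘ x) e3) _.
  apply: etrans (compA _ _ _) _; apply: etrans _ (esym (compA _ _ _)).
  by rewrite -(stable_morM w2) wc stable_morM.
Qed.

Lemma exact_equivalence_stable :
  exists G : triangle_functor (stable_triangulated A) (stable_triangulated B),
    is_equivalence G.
Proof.
exists (@TriangleFunctor (stable_triangulated A) (stable_triangulated B)
  stable_functor (fun X => stable_mor (shift_mor X)) shift_mor_natural
  stable_functor_exact).
exact: stable_functor_equivalence.
Qed.

End ExactEquivalence.

(** * The equivalence from monomorphisms to pairs *)

Section MonPair.
Variables (S : comNzRingType) (omega : S).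
Local Notation Mon := (mon_preadditive omega).
Local Notation Pair := (pair_preadditive omega).

Lemma mon_pair_full (X Y : Mon)
    (h : hom (mon_pair_functor omega X) (mon_pair_functor omega Y)) :
  exists f, fmap (mon_pair_functor omega) f = h.
Proof.
have e x : ph0 h (mon_map X x) = mon_map Y (ph1 h x) by exact/esym/(ph0E h).
by exists (MonHom e); apply: pair_hom_ext.
Qed.

Lemma mon_pair_faithful (X Y : Mon) (f g : hom X Y) :
  fmap (mon_pair_functor omega) f = fmap (mon_pair_functor omega) g -> f = g.
Proof.
move=> e; apply: mon_hom_ext => x; first exact: (pair_homP1 e).
exact: (pair_homP0 e).
Qed.

(** As [rho0 ∘ rho1] is multiplication by [omega], injective on a projective module, [rho1 Y] is a
    monomorphism; [rho0 Y] is then its only complement to [omega]. *)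
Lemma mon_pair_ess (reg : GRing.lreg omega) (Y : Pair) :
  exists X (e : hom (mon_pair_functor omega X) Y), is_iso e.
Proof.
have inj : injective (rho1 Y).
  move=> x y e; apply/eqP; rewrite -subr_eq0; apply/eqP.
  apply: (fgproj_torsion_free reg).
  by rewrite -rho01 linearB e subrr linear0.
have cok y : exists x, rho1 Y x = omega *: y by exists (rho0 Y y); rewrite rho10.
pose X : Mon := MonObj inj cok.
have e x : mon_inv X x = rho0 Y x.
  by apply: (inj); rewrite rho10 (mon_invK (X := X)).
have e' x : rho0 Y x = mon_inv X x by [].
by exists X, (@PairHom _ _ (mon_pair X) Y idfun idfun e (fun=> erefl)),
  (@PairHom _ _ Y (mon_pair X) idfun idfun e' (fun=> erefl));
  split; apply: pair_hom_ext.
Qed.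

End MonPair.

Theorem theorem3p2 (S : comNzRingType) (n : S -> Prop)
    (S_noetherian : noetherian S) (S_local : local_ring n)
    (omega : S) (omega_in_n : n omega) (omega_reg : GRing.lreg omega) :
  exists F : triangle_functor (stable_triangulated (Mon omega_reg))
                              (stable_triangulated (Pair omega)),
    is_equivalence F.
Proof.
apply: (@exact_equivalence_stable (Mon omega_reg) (Pair omega)
  (mon_pair_functor omega)).
- exact: mon_pair_full.
- exact: mon_pair_faithful.
- exact: mon_pair_ess.
(* The functor keeps the underlying linear maps, so both conflation conditions are the same by
   conversion. *)
- by [].
Qed.
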